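(* Let $\alpha\in(1,2]$, $\eta\in(0,1]$, $\theta\in(0,\tfrac12)$, $\lambda\in[0,\tfrac{2}{\eta^2})$, and let $f\in C([0,1]\times[0,\infty),[0,\infty))$. Let $$f^{0}=\lim_{x\to 0^{+}}\max_{t\in[0,1]}\frac{f(t,x)}{x},\qquad f_{\infty}=\lim_{x\to+\infty}\min_{t\in[0,1]}\frac{f(t,x)}{x}$$ (limits in $[0,+\infty]$, assumed to exist), and let $$\Lambda_1=\Bigg(\theta^4\int_\theta^{1-\theta}\Big(\mathcal G(s,s)+\frac{\lambda}{2-\lambda\eta^2}\mathcal H(\eta,s)\Big)ds\Bigg)^{-1},\qquad \Lambda_2=\Bigg(\Big(1+\frac{\lambda}{2-\lambda\eta^2}\Big)\int_0^1\mathcal G(s,s)\,ds\Bigg)^{-1}.$$ If $f^0<\Lambda_2$ and $f_\infty>\Lambda_1$, then the boundary value problem $$D^\alpha x(t)+f(t,x(t))=0,\quad t\in[0,1],\qquad x(0)=0,\quad x(1)=\lambda\int_0^\eta x(t)\,dt,$$ has at least one positive solution.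
   Context: Conformable derivative: for $\alpha\in(1,2]$ and a function $x$ that is differentiable at points $t>0$, $D^\alpha x(t)=\lim_{\epsilon\to0}\frac{x'(t+\epsilon t^{2-\alpha})-x'(t)}{\epsilon}$ for $t>0$, provided the limit exists (one-sided at the right endpoint of the interval); equivalently $D^\alpha x(t)=t^{2-\alpha}x''(t)$ for $t>0$. At $t=0$, $D^\alpha x(0)=\lim_{t\to0^+}D^\alpha x(t)$, provided this limit exists. A solution of the boundary value problem is a function $x\in C([0,1],\mathbb R)$, differentiable on $(0,1]$, for which $D^\alpha x$ exists on $[0,1]$, and which satisfies the equation and the boundary conditions. A positive solution is a solution $x$ with $x(t)\ge0$ for all $t\in[0,1]$ and $x\not\equiv0$. The functions $\mathcal G,\mathcal H$ are, for $t\in[0,1]$ and $s\in(0,1]$, $$\mathcal G(t,s)=\begin{cases}(1-t)s^{\alpha-1},& s\le t,\\ t(1-s)s^{\alpha-2},& t\le s,\end{cases}\qquad \mathcal H(t,s)=\begin{cases}(2t-t^2-s)s^{\alpha-1},& s\le t,\\ t^2(1-s)s^{\alpha-2},& t\le s.\end{cases}$$ In particular $\mathcal G(s,s)=(1-s)s^{\alpha-1}$. *)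

(* Defs.v *)
From HB Require Import structures.
From mathcomp Require Import all_boot all_order all_algebra.
From mathcomp Require Import all_classical all_reals all_analysis.

Set Implicit Arguments.
Unset Strict Implicit.
Unset Printing Implicit Defensive.

Import Order.TTheory GRing.Theory Num.Theory.
Import numFieldNormedType.Exports.

Local Open Scope classical_set_scope.
Local Open Scope ring_scope.

(* A function on [0, 1] is represented by a total function R -> R; every notion
   below only looks at its values on [0, 1]. *)

(* The increments h <> 0 with t + h still in [0, 1]: limits along [incr01 t]
   are one-sided at the endpoints and two-sided inside. *)
Definition incr01 (R : realType) (t : R) : set_system R :=
  within (fun h => t + h \in `[0, 1]) (nbhs 0^').

Definition derivable01 (R : realType) (x : R -> R) (t : R) : Prop :=
  cvg ((x (t + h) - x t) / h @[h --> incr01 t]).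

Definition deriv01 (R : realType) (x : R -> R) (t : R) : R :=
  lim ((x (t + h) - x t) / h @[h --> incr01 t]).

(* The increments e <> 0 with t + e * t^(2 - alpha) in (0, 1], where x' is
   defined. *)
Definition conf_incr (R : realType) (alpha t : R) : set_system R :=
  within (fun e => t + e * t `^ (2 - alpha) \in `]0, 1]) (nbhs 0^').

Definition conf_quot (R : realType) (alpha : R) (x : R -> R) (t e : R) : R :=
  (deriv01 x (t + e * t `^ (2 - alpha)) - deriv01 x t) / e.

Definition conf_derive_pos (R : realType) (alpha : R) (x : R -> R) (t : R) : R :=
  lim (conf_quot alpha x t e @[e --> conf_incr alpha t]).

Definition conf_derive (R : realType) (alpha : R) (x : R -> R) (t : R) : R :=
  if t == 0 then lim (conf_derive_pos alpha x s @[s --> 0^'+])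
  else conf_derive_pos alpha x t.

(* For x differentiable on (0, 1]: D^alpha x exists (as a real number) at every
   point of [0, 1]. *)
Definition conf_derivable (R : realType) (alpha : R) (x : R -> R) : Prop :=
  (forall t : R, t \in `]0, 1] ->
     cvg (conf_quot alpha x t e @[e --> conf_incr alpha t])) /\
  cvg (conf_derive_pos alpha x s @[s --> 0^'+]).

Definition bvp_solution (R : realType) (alpha eta lambda : R)
    (f : R -> R -> R) (x : R -> R) : Prop :=
  [/\ {within `[0, 1], continuous x},
      forall t : R, t \in `]0, 1] -> derivable01 x t,
      conf_derivable alpha x,
      forall t : R, t \in `[0, 1] -> conf_derive alpha x t + f t (x t) = 0 &
      x 0 = 0 /\
      x 1 = lambda * (\int[lebesgue_measure]_(t in `[0, eta]) x t)%R].

Definition positive_solution (R : realType) (alpha eta lambda : R)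
    (f : R -> R -> R) (x : R -> R) : Prop :=
  [/\ bvp_solution alpha eta lambda f x,
      forall t : R, t \in `[0, 1] -> 0 <= x t &
      exists2 t : R, t \in `[0, 1] & x t != 0].

Definition calG (R : realType) (alpha t s : R) : R :=
  if s <= t then (1 - t) * s `^ (alpha - 1)
  else t * (1 - s) * s `^ (alpha - 2).

Definition calH (R : realType) (alpha t s : R) : R :=
  if s <= t then (2 * t - t ^+ 2 - s) * s `^ (alpha - 1)
  else t ^+ 2 * (1 - s) * s `^ (alpha - 2).

Definition Lambda1 (R : realType) (alpha eta theta lambda : R) : R :=
  (theta ^+ 4 *
   (\int[lebesgue_measure]_(s in `[theta, 1 - theta])
      (calG alpha s s
       + lambda / (2 - lambda * eta ^+ 2) * calH alpha eta s))%R)^-1.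

Definition Lambda2 (R : realType) (alpha eta lambda : R) : R :=
  ((1 + lambda / (2 - lambda * eta ^+ 2)) *
   (\int[lebesgue_measure]_(s in `[0, 1]) calG alpha s s)%R)^-1.

(* Attained for continuous g, see [max01_attained] and [min01_attained]. *)
Definition max01 (R : realType) (g : R -> R) : R := sup (g @` `[0, 1]).

Definition min01 (R : realType) (g : R -> R) : R := inf (g @` `[0, 1]).

Lemma max01_attained (R : realType) (g : R -> R) :
  {within `[0, 1], continuous g} ->
  exists2 c : R, c \in `[0, 1] &
    max01 g = g c /\ forall t : R, t \in `[0, 1] -> g t <= g c.
Proof.
move=> cg; have [c c01 gc] := EVT_max ler01 cg.
exists c => //; split=> //; apply/eqP; rewrite eq_le; apply/andP; split.
  apply: ge_sup; first by exists (g c), c.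
  by move=> _ [t t01 <-]; exact: gc.
apply: ub_le_sup; last by exists c.
by exists (g c) => _ [t t01 <-]; exact: gc.
Qed.

Lemma min01_attained (R : realType) (g : R -> R) :
  {within `[0, 1], continuous g} ->
  exists2 c : R, c \in `[0, 1] &
    min01 g = g c /\ forall t : R, t \in `[0, 1] -> g c <= g t.
Proof.
move=> cg; have [c c01 gc] := EVT_min ler01 cg.
exists c => //; split=> //; apply/eqP; rewrite eq_le; apply/andP; split.
  apply: ge_inf; last by exists c.
  by exists (g c) => _ [t t01 <-]; exact: gc.
apply: lb_le_inf; first by exists (g c), c.
by move=> _ [t t01 <-]; exact: gc.
Qed.

(* Main.v *)
Require Import Defs.
From HB Require Import structures.
From mathcomp Require Import all_boot all_order all_algebra.
From mathcomp Require Import all_classical all_reals all_analysis.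
From mathcomp Require Import ring lra.

Set Implicit Arguments.
Unset Strict Implicit.
Unset Printing Implicit Defensive.

Import Order.TTheory GRing.Theory Num.Theory.
Import numFieldNormedType.Exports.

Local Open Scope classical_set_scope.
Local Open Scope ring_scope.

(** For t > 0 the equation D^alpha x + f(t, x) = 0 is
    x'' = - t^(alpha - 2) f(t, x), whose weight is singular but integrable at 0.
    The proof shoots from 0: let x solve it with x(0) = 0 and x'(0) = m, and put
    B(m) = x(1) - lambda * (integral of x over [0, eta]).  A zero of B with m > 0
    is a positive solution, because x is concave and lambda eta^2 < 2 forces
    x(1) >= 0 ([bc_nonneg]).

    The sign of B comes from two identities valid for every such x, with
    g(s) = f(s, x(s)):
      x(t) - t x(1) = integral of G(t, s) g(s) ds,
      2 (integral of x over [0, eta]) - eta^2 x(1) = integral of H(eta, s) g(s) ds.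
    - For small m the solution stays small, so g <= k max x with k < Lambda2.
      If B(m) <= 0, the identities and G(t, s), H(eta, s) <= G(s, s) bound x by
      k (1 + lambda / (2 - lambda eta^2)) max x * (integral of G(s, s)), which is
      less than max x.  So B(m) > 0 ([small_slope]).
    - For large m, if B(m) >= 0 then x is nonnegative and concave, hence at least
      theta max x on [theta, 1 - theta], and max x is large; then g >= k theta max x
      there with k > Lambda1, and the identities at t = 1/2 give x(1/2) > max x.
      So B(m) < 0 ([large_slope]).

    Since f is only continuous, solutions need not be determined by m and B need
    not be a function.  The intermediate value theorem is therefore applied to
    Euler schemes, on which B is a continuous function of m, and the mesh is sent
    to 0 along an ultrafilter on the natural numbers ([shooting]).  Bounded
    sequences converge along an ultrafilter, so the schemes have a limit at all t
    simultaneously, and the two-sided bounds on their increments pass to the limit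
    and become the differential equation ([ulim_increment], [ulim_derive]).

    The identities are never written with integrals: G(t, s) g(s) and
    H(eta, s) g(s) have explicit primitives in terms of x and x' ([greenG],
    [greenH]), so comparing derivatives is enough, and Lebesgue integrals enter
    only as increments of primitives of continuous functions. *)

(** * Comparison of increments and primitives *)

Section Calculus.
Context {R : realType}.
Implicit Types (f g F : R -> R) (a b c e s t : R).

Lemma is_derive_continuous F s (d : R) : is_derive s 1 F d -> {for s, continuous F}.
Proof. by case=> dF _; exact/differentiable_continuous/derivable1_diffP. Qed.

(** The exceptional points es are where glued primitives change formula. *)
Lemma nondecr_except (es : seq R) F (F' : R -> R) a b : a <= b ->
  (forall s, a <= s <= b -> {for s, continuous F}) ->
  (forall s, a < s < b -> s \notin es -> is_derive s 1 F (F' s) /\ 0 <= F' s) ->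
  F a <= F b.
Proof.
elim: es a b => [|e es IH] a b ab cF dF.
  have cw : {within `[a, b], continuous F}.
    by apply: continuous_in_subspaceT => s; rewrite inE/= in_itv/=; exact: cF.
  move: ab; rewrite le_eqVlt => /predU1P[->//|ab].
  have dF' s : s \in `]a, b[ -> is_derive s 1 F (F' s).
    by rewrite in_itv/= => /dF /(_ isT) [].
  have [c] := MVT ab dF' cw; rewrite in_itv/= => /dF /(_ isT) [_ Fc] Fab.
  by rewrite -subr_ge0 Fab mulr_ge0// subr_ge0 ltW.
(* Splitting at e clamped to [a, b]: e is not interior to either half. *)
pose c := Num.min (Num.max e a) b.
have ac : a <= c by rewrite /c le_min ab le_max lexx orbT.
have cb : c <= b by rewrite /c ge_min lexx orbT.
apply: (@le_trans _ _ (F c)); apply: IH => // s.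
- by move=> /andP[as_ sc]; apply: cF; lra.
- move=> /andP[as_ sc] ses; apply: dF; first by lra.
  rewrite inE negb_or ses andbT lt_eqF//.
  by move: sc; rewrite /c lt_min lt_max => /andP[/orP[//|]]; lra.
- by move=> /andP[cs sb]; apply: cF; lra.
- move=> /andP[cs sb] ses; apply: dF; first by lra.
  rewrite inE negb_or ses andbT gt_eqF//.
  by move: cs; rewrite /c gt_min gt_max => /orP[/andP[]//|]; lra.
Qed.

Lemma le_increment (es : seq R) F F' g g' a b : a <= b ->
  (forall s, a <= s <= b -> {for s, continuous F}) ->
  (forall s, a <= s <= b -> {for s, continuous g}) ->
  (forall s, a < s < b -> s \notin es ->
    [/\ is_derive s 1 F (F' s), is_derive s 1 g (g' s) & F' s <= g' s]) ->
  F b - F a <= g b - g a.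
Proof.
move=> ab cF cg dFg.
suff : (g - F) a <= (g - F) b by rewrite !fctE; lra.
apply: (@nondecr_except es _ (fun s => g' s - F' s)) => // s sab.
  by apply: continuousB; [exact: cg|exact: cF].
by move=> /(dFg _ sab)[dF dg le]; split; [exact: is_deriveB|rewrite subr_ge0].
Qed.

Lemma antiderivative f a b : continuous f -> a <= b ->
  exists2 F, (forall s, a <= s <= b -> is_derive s 1 F (f s)) &
    F b - F a = (\int[lebesgue_measure]_(s in `[a, b]) f s)%R.
Proof.
move=> cf ab.
have intf u v : lebesgue_measure.-integrable `[u, v] (EFin \o f).
  apply: continuous_compact_integrable; first exact: segment_compact.
  exact: continuous_subspaceT.
exists (fun x => \int[lebesgue_measure]_(t in `[a - 1, x]) f t)%R.
  move=> s /andP[as_ sb].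
  have [||dF <-] := @continuous_FTC1_closed R f (a - 1) s (b + 1) _ (intf _ _) _ (cf s).
  - by lra.
  - by lra.
  - by rewrite derive1E; exact: derivableP.
rewrite (@Rintegral_itvB _ f (BLeft (a - 1)) (BRight b) a) ?bnd_simp//; last by lra.
rewrite Rintegral_itv_obnd_cbnd//.
by apply: integrableS (intf a b) => //; exact: subset_itv_oc_cc.
Qed.

(** A Green kernel has one formula on each side of e.  If F1 and F2 are primitives
    of the two formulas, [glue e F1 F2] is a primitive of the kernel away from e, and
    its increment over [0, 1] is F1 e - F1 0 + (F2 1 - F2 e) whether or not F1 e and
    F2 e agree. *)
Definition glue e F1 F2 s := F1 (Num.min s e) + F2 (Num.max s e).

Lemma glue_continuous e F1 F2 : continuous F1 -> continuous F2 ->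
  continuous (glue e F1 F2).
Proof.
move=> c1 c2 s; apply: continuousD.
  apply: (@continuous_comp _ _ _ (id \min cst e) F1); last exact: c1.
  by apply: continuous_min; [exact: cvg_id|exact: cvg_cst].
apply: (@continuous_comp _ _ _ (id \max cst e) F2); last exact: c2.
by apply: continuous_max; [exact: cvg_id|exact: cvg_cst].
Qed.

Lemma glue_derive_lt e F1 F2 s d : s < e -> is_derive s 1 F1 d ->
  is_derive s 1 (glue e F1 F2) d.
Proof.
move=> se d1; apply: (@near_eq_is_derive _ _ _ (F1 + cst (F2 e)) _ s 1 d).
  near=> u.
  have ue : u < e by near: u; exact: lt_nbhsl.
  by rewrite /glue !fctE min_l ?max_r ?ltW.
by rewrite -[d]addr0; exact: is_deriveD.
Unshelve. all: by end_near. Qed.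

Lemma glue_derive_gt e F1 F2 s d : e < s -> is_derive s 1 F2 d ->
  is_derive s 1 (glue e F1 F2) d.
Proof.
move=> se d1; apply: (@near_eq_is_derive _ _ _ (cst (F1 e) + F2) _ s 1 d).
  near=> u.
  have ue : e < u by near: u; exact: lt_nbhsr.
  by rewrite /glue !fctE min_r ?max_l ?ltW.
by rewrite -[d]add0r; exact: is_deriveD.
Unshelve. all: by end_near. Qed.

End Calculus.

Section DifferenceQuotient.
Context {R : realType}.
Implicit Types (f Q : R -> R) (t d q : R).

Lemma is_derive_quotientP f t d :
  is_derive t 1 f d <-> (f (t + h) - f t) / h @[h --> 0^'] --> d.
Proof.
have E : (fun h : R => h^-1 *: ((f \o shift t) (h *: 1) - f t)) =
         (fun h => (f (t + h) - f t) / h).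
  by apply/funext => h /=; rewrite /GRing.scale/= mulr1 (addrC h) mulrC.
split=> [[]|fd].
  by rewrite /derivable /derive E => /[swap] <-.
apply: DeriveDef; rewrite ?/derivable ?/derive E; last exact: cvg_lim.
by apply/cvg_ex; exists d.
Qed.

(** Differentiation of f relative to Q.  It separates the limit of the difference
    scheme, where only increments of Q appear, from the weight Q'. *)
Lemma is_derive_relative f Q t beta q :
  (forall e, 0 < e -> \forall s \near t,
     `|f s - f t - beta * (Q s - Q t)| <= e * `|Q s - Q t|) ->
  is_derive t 1 Q q -> is_derive t 1 f (beta * q).
Proof.
move=> fQ /is_derive_quotientP dQ; apply/is_derive_quotientP.
pose r h := (f (t + h) - f t - beta * (Q (t + h) - Q t)) / h.
have -> : (fun h => (f (t + h) - f t) / h) =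
          (fun h => beta * ((Q (t + h) - Q t) / h) + r h).
  by apply/funext => h; rewrite /r; ring.
rewrite -[beta * q]addr0; apply: cvgD.
  by apply: cvgM => //; exact: cvg_cst.
apply/cvgr0Pnorm_le => e e0.
have q0 : 0 < `|q| + 1 by rewrite ltr_wpDl.
have t0 : t + h @[h --> 0^'] --> t.
  rewrite -[X in _ --> X]addr0; apply: cvgD; first exact: cvg_cst.
  exact: cvg_within.
have {}fQ := t0 _ (fQ _ (divr_gt0 e0 q0)).
have Qb : \forall h \near 0^', `|(Q (t + h) - Q t) / h| < `|q| + 1.
  by apply: (cvgr_norm_lt _ dQ); rewrite ltrDl.
near=> h.
rewrite /r normrM normfV.
have h0 : h != 0 by near: h; exact: nbhs_dnbhs_neq.
rewrite ler_pdivrMr ?normr_gt0//.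
have := near Qb h; rewrite normrM normfV.
move=> /(_ _)/wrap[]//; rewrite ltr_pdivrMr ?normr_gt0// => Qh.
have fh : `|f (t + h) - f t - beta * (Q (t + h) - Q t)| <=
  e / (`|q| + 1) * `|Q (t + h) - Q t| by near: h.
apply: (le_trans fh).
apply: (@le_trans _ _ (e / (`|q| + 1) * ((`|q| + 1) * `|h|))).
  by rewrite ler_wpM2l ?divr_ge0 ?ltW.
by rewrite mulrA divfK ?gt_eqF.
Unshelve. all: by end_near. Qed.

End DifferenceQuotient.

(** * Limits of difference schemes along an ultrafilter *)

Section Grid.
Context {R : realType}.

(** The mesh of the n-th grid is 1/(n + 1), and [node_index n t] is the last node
    before t, or 0 when t is negative. *)
Definition node (n k : nat) : R := k%:R / n.+1%:R.

Definition node_index (n : nat) (t : R) : nat := Num.truncn (t * n.+1%:R).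

Lemma node0 n : node n 0 = 0. Proof. by rewrite /node mul0r. Qed.

Lemma le_node n : {homo node n : i j / (i <= j)%N >-> i <= j}.
Proof. by move=> i j ij; rewrite ler_pM2r ?invr_gt0// ler_nat. Qed.

Lemma node_index_le n t : 0 <= t -> node n (node_index n t) <= t.
Proof.
move=> t0; rewrite ler_pdivrMr//.
by have /andP[] := truncn_itv (mulr_ge0 t0 (ler0n _ n.+1)).
Qed.

Lemma node_index_gt n t : 0 <= t -> t - n.+1%:R^-1 < node n (node_index n t).
Proof.
move=> t0; rewrite ltrBlDr /node -[X in _ + X]mul1r -mulrDl ltr_pdivlMr//.
have /andP[_] := truncn_itv (mulr_ge0 t0 (ler0n _ n.+1)).
by rewrite natr1.
Qed.

Lemma node_index_le0 n t : t <= 0 -> node_index n t = 0%N.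
Proof.
move=> t0; apply/truncn0Pn; rewrite -ltNge.
by apply: (@le_lt_trans _ _ 0) => //; rewrite mulr_le0_ge0.
Qed.

(** A discrete mean value inequality for the scheme with increments dQ * b; the
    continuous one is obtained from it in the limit. *)
Lemma increment_bounds (Q a b : nat -> R) lo hi i j : (i <= j)%N ->
  (forall k, a k.+1 = a k + (Q k.+1 - Q k) * b k) ->
  (forall k, Q k <= Q k.+1) ->
  (forall k, (i <= k < j)%N -> lo <= b k <= hi) ->
  lo * (Q j - Q i) <= a j - a i <= hi * (Q j - Q i).
Proof.
move=> ij aS QS; elim: j ij => [|j IH].
  by rewrite leqn0 => /eqP -> _; rewrite !subrr !mulr0 lexx.
rewrite leq_eqVlt => /predU1P[-> _|]; first by rewrite !subrr !mulr0 lexx.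
rewrite ltnS => ij bj.
have {}IH : lo * (Q j - Q i) <= a j - a i <= hi * (Q j - Q i).
  by apply: IH => // k /andP[ik kj]; apply: bj; rewrite ik ltnW.
have /andP[lb bh] : lo <= b j <= hi by apply: bj; rewrite ij ltnSn.
have Q0 : 0 <= Q j.+1 - Q j by rewrite subr_ge0.
rewrite aS; move: IH.
move: (ler_wpM2l Q0 lb) (ler_wpM2l Q0 bh); lra.
Qed.

End Grid.

Section UltraLimit.
Context {R : realType} (U : set_system nat) {UU : UltraFilter U}.
Hypothesis (hU : \oo `<=` U).
Implicit Types (a b : nat -> nat -> R) (t : R).

(** Compactness of [-M, M].  As nothing is extracted, the same ultrafilter serves
    all sequences at once. *)
Lemma ultra_cvg (u : nat -> R) M : (forall n, `|u n| <= M) -> cvg (u @ U).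
Proof.
move=> uM; have := @segment_compact R (- M) M; rewrite compact_ultra.
have FU : UltraFilter (u @ U).
  split=> [|G GF uG]; first exact: fmap_proper_filter.
  apply/seteqP; split=> [A GA|]; last exact: uG.
  have [//|UA] := in_ultra_setVsetC (u @^-1` A) UU.
  have /uG GnA : (u @ U) (~` A) by [].
  by have /filter_ex[x []] : G (A `&` ~` A) by exact: filterI.
case/(_ _ FU) => [|l [_ ul]]; last by apply/cvg_ex; exists l.
by apply: (@filterE _ U) => n; rewrite /= in_itv/= -ler_norml; exact: uM.
Qed.

(** The pairs (n, k) whose node is infinitely close to t.  Convergence along this
    filter is what survives of uniform convergence near t, and it lets limits of
    composed quantities be taken with the usual rules. *)
Definition grid t : set_system (nat * nat) := [set S | exists2 d, 0 < d &
  \forall n \near U, forall k, `|node n k - t| < d -> S (n, k)].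

Global Instance grid_filter t : Filter (grid t).
Proof.
split; first by exists 1 => //; apply: filterE.
- move=> A B [d d0 dA] [e e0 eB]; exists (Num.min d e).
    by rewrite lt_min d0.
  apply: filterS2 dA eB => n dA eB k; rewrite lt_min => /andP[kd ke].
  by split; [exact: dA|exact: eB].
- move=> A B AB [d d0 dA]; exists d => //.
  by apply: filterS dA => n dA k kd; exact/AB/dA.
Qed.

Lemma near_node_index t d : 0 <= t -> 0 < d ->
  \forall n \near U, `|node n (node_index n t) - t| < d.
Proof.
move=> t0 d0; apply: hU; apply: filterS (near_infty_natSinv_lt (PosNum d0)) => n /= nd.
have := node_index_le n t0; have := node_index_gt n t0.
have : n.+1%:R^-1 < d by [].
by rewrite ltr_norml; move: (n.+1%:R^-1) (node _ _) => u v; lra.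
Qed.

Lemma node_cvg t : node nk.1 nk.2 @[nk --> grid t] --> t.
Proof.
by apply/cvgrPdistC_lt => e e0; exists e => //; apply: filterE.
Qed.

Lemma grid_index a t (l : R) : 0 <= t -> a nk.1 nk.2 @[nk --> grid t] --> l ->
  a n (node_index n t) @[n --> U] --> l.
Proof.
move=> t0 al S /al [d d0 dS].
by apply: filterS2 dS (near_node_index t0 d0) => n /[apply].
Qed.

Definition locally_bounded a :=
  forall T : R, exists C : R, forall n k, node n k <= T -> `|a n k| <= C.

Definition ulim a t : R := lim (a n (node_index n t) @[n --> U]).

(** A scheme a with increments dQ * b discretizes dA = b dQ; its limit A is shown
    to satisfy this equation. *)
Section Scheme.
Context (Q : R -> R) a b (M : R).
Hypotheses (cQ : continuous Q) (ndQ : {homo Q : s t / s <= t}).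
Hypotheses (a0 : forall n, `|a n 0%N| <= M) (bb : locally_bounded b).
Hypothesis aS : forall n k,
  a n k.+1 = a n k + (Q (node n k.+1) - Q (node n k)) * b n k.

Lemma scheme_increment T C n i j :
  (forall n k, node n k <= T :> R -> `|b n k| <= C) ->
  node n i <= T -> node n j <= T ->
  `|a n j - a n i| <= C * `|Q (node n j) - Q (node n i)|.
Proof.
move=> bC; wlog ij : i j / (i <= j)%N => [wl iT jT|_ jT].
  case/orP: (leq_total i j) => ij; first exact: wl.
  by rewrite distrC (distrC (Q _)); exact: wl.
rewrite (ger0_norm (x := Q _ - _)); last by rewrite subr_ge0; exact/ndQ/le_node.
rewrite ler_norml -mulNr; apply: (increment_bounds ij (aS n)) => [k|k /andP[_ kj]].
  exact/ndQ/le_node.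
by rewrite -ler_norml; apply: bC; apply: le_trans jT; apply: le_node; exact: ltnW.
Qed.

Lemma scheme_bounded : locally_bounded a.
Proof.
move=> T; have [C bC] := bb T.
exists (M + C * `|Q T - Q 0|) => n k kT.
have T0 : node n 0 <= T by apply: le_trans kT; exact: le_node.
rewrite -[a n k](subrK (a n 0%N)) addrC; apply: (le_trans (ler_normD _ _)).
apply: lerD => //; apply: (le_trans (scheme_increment bC T0 kT)).
rewrite ler_wpM2l//; first exact: le_trans (bC _ _ T0).
have Q0k : Q (node n 0) <= Q (node n k) by exact/ndQ/le_node.
have QkT : Q (node n k) <= Q T by exact: ndQ.
by move: Q0k; rewrite node0 => Q0k; rewrite !ger0_norm ?subr_ge0 ?lerB// (le_trans Q0k).
Qed.

Lemma scheme_cvg t : a n (node_index n t) @[n --> U] --> ulim a t.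
Proof.
have [C aC] := scheme_bounded (Num.max t 0).
apply: (@ultra_cvg _ C) => n; apply: aC; rewrite le_max.
have [t0|t0] := leP 0 t; first by rewrite node_index_le.
by rewrite node_index_le0 ?node0 ?lexx ?orbT// ltW.
Qed.

(** All nodes near t give the same limit: the values of b are locally bounded, so
    the scheme varies little between two nodes when Q does. *)
Lemma scheme_grid t : 0 <= t -> a nk.1 nk.2 @[nk --> grid t] --> ulim a t.
Proof.
move=> t0; have [C bC] := bb (t + 1).
have C0 : 0 <= C by apply: le_trans (bC 0%N 0%N _); rewrite ?node0// addr_ge0.
apply/cvgrPdistC_lt => e e0.
pose e' := e / (4 * (C + 1)).
have e'0 : 0 < e' by rewrite divr_gt0// mulr_gt0// ltr_wpDl.
have /cvgrPdist_lt/(_ _ e'0) [d /= d0 dQ] := @cQ t.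
have d1 : 0 < Num.min d 1 by rewrite lt_min d0 /=.
exists (Num.min d 1) => //.
have ae : \forall n \near U, `|a n (node_index n t) - ulim a t| < e / 2.
  by move/cvgrPdistC_lt: (@scheme_cvg t); apply; rewrite divr_gt0.
apply: filterS2 ae (near_node_index t0 d1) => n; rewrite !lt_min.
set j := node_index n t => aj /andP[jd j1] k; rewrite lt_min => /andP[kd k1].
have near1 i : `|node n i - t| < 1 -> node n i <= t + 1.
  by rewrite ltr_norml => /andP[_]; lra.
have jk := scheme_increment bC (near1 _ j1) (near1 _ k1).
have Qj : `|Q t - Q (node n j)| < e' by apply: dQ; rewrite /= distrC.
have Qk : `|Q t - Q (node n k)| < e' by apply: dQ; rewrite /= distrC.
have Qjk : `|Q (node n k) - Q (node n j)| <= 2 * e'.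
  by move: Qj Qk; rewrite !ltr_norml ler_norml; lra.
have {jk}: `|a n k - a n j| < e / 2.
  apply: (le_lt_trans jk); apply: (@le_lt_trans _ _ (C * (2 * e'))).
    exact: ler_wpM2l.
  have C1 : C + 1 != 0 by rewrite gt_eqF// ltr_wpDl.
  have -> : e / 2 = (C + 1) * (2 * e') by rewrite /e'; field.
  by rewrite ltr_pM2r; [rewrite ltrDl|rewrite mulr_gt0].
by move: aj; rewrite /= !ltr_norml; lra.
Qed.

(** The mean value inequality of the scheme survives at the limit because Q is
    continuous at both ends. *)
Lemma ulim_increment lo hi t1 t2 : 0 <= t1 -> t1 <= t2 ->
  (exists2 d, 0 < d & \forall n \near U, forall k,
     t1 - d < node n k <= t2 -> lo <= b n k <= hi) ->
  lo * (Q t2 - Q t1) <= ulim a t2 - ulim a t1 <= hi * (Q t2 - Q t1).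
Proof.
move=> t10 t12 [d d0 bd]; have t20 := le_trans t10 t12.
pose I n t := node_index n t.
have cvgQ t : 0 <= t -> Q (node n (I n t)) @[n --> U] --> Q t.
  move=> t0; apply: (@cvg_comp _ _ _ (fun n => node n (I n t)) Q _ (nbhs t)).
    2: exact: cQ.
  by apply: (grid_index (a := @node R) t0); exact: node_cvg.
have cQQ c : c * (Q (node n (I n t2)) - Q (node n (I n t1))) @[n --> U]
    --> c * (Q t2 - Q t1).
  by apply: cvgM; [exact: cvg_cst|apply: cvgB; exact: cvgQ].
have caa : a n (I n t2) - a n (I n t1) @[n --> U] --> ulim a t2 - ulim a t1.
  by apply: cvgB; exact: scheme_cvg.
have step : \forall n \near U,
    lo * (Q (node n (I n t2)) - Q (node n (I n t1)))
    <= a n (I n t2) - a n (I n t1)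
    <= hi * (Q (node n (I n t2)) - Q (node n (I n t1))).
  apply: filterS2 bd (near_node_index t10 d0) => n bd Id.
  apply: (increment_bounds _ (aS n)) => [|k|k /andP[ik kj]].
  - by apply: le_truncn; rewrite ler_wpM2r.
  - exact/ndQ/le_node.
  - apply: bd; apply/andP; split.
      apply: lt_le_trans (le_node n ik).
      by move: Id; rewrite /I ltr_norml => /andP[]; lra.
    by apply: le_trans (node_index_le n t20); apply: le_node; exact: ltnW.
apply/andP; split; [apply: (ler_cvg_to (cQQ lo) caa)|apply: (ler_cvg_to caa (cQQ hi))].
  by apply: filterS step => n /andP[].
by apply: filterS step => n /andP[].
Qed.

Lemma ulim_le0 t : t <= 0 -> ulim a t = ulim a 0.
Proof.
move=> t0; rewrite /ulim.
suff -> : (fun n => a n (node_index n t)) = (fun n => a n (node_index n (0 : R))).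
  by [].
by apply/funext => n; rewrite !node_index_le0.
Qed.

Lemma ulim_continuous : continuous (ulim a).
Proof.
pose Q' := Q \o (id \max cst 0).
have cQ' : continuous Q'.
  move=> s; apply: continuous_comp; last exact: cQ.
  by apply: continuous_max; [exact: cvg_id|exact: cvg_cst].
move=> t; pose T := `|t| + 1; have [C bC] := bb T.
have T0 : 0 <= T by rewrite addr_ge0.
have C0 : 0 <= C by apply: le_trans (bC 0%N 0%N _); rewrite ?node0.
have incr s u : s <= T -> u <= T -> `|ulim a s - ulim a u| <= C * `|Q' s - Q' u|.
  wlog us : s u / u <= s => [wl sT uT|sT uT].
    case/orP: (le_total u s) => us; first exact: wl.
    by rewrite distrC (distrC (Q' s)); exact: wl.
  have max0 v : ulim a v = ulim a (Num.max v 0).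
    by case: (leP v 0) => // /ulim_le0.
  rewrite (max0 s) (max0 u) (ger0_norm (x := Q' s - _)); last first.
    by rewrite subr_ge0; apply: ndQ; rewrite ge_max !le_max us lexx !orbT.
  rewrite ler_norml -mulNr; apply: ulim_increment.
  - by rewrite le_max lexx orbT.
  - by rewrite ge_max !le_max us lexx !orbT.
  - exists 1 => //; apply: filterE => n k /andP[_ ks].
    by rewrite -ler_norml; apply: bC; rewrite (le_trans ks)// ge_max sT.
apply/cvgrPdist_lt => e e0.
have e'0 : 0 < e / (C + 1) by rewrite divr_gt0// ltr_wpDl.
have /cvgrPdist_lt/(_ _ e'0) [d /= d0 dQ] := @cQ' t.
exists (Num.min d 1); first by rewrite /= lt_min d0 /=.
move=> s /=; rewrite lt_min => /andP[sd s1].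
apply: (@le_lt_trans _ _ (C * `|Q' t - Q' s|)).
  apply: incr; first by rewrite /T (le_trans (ler_norm t)) ?lerDl.
  by move: s1 (ler_norm t); rewrite /T ltr_norml; lra.
apply: (@le_lt_trans _ _ (C * (e / (C + 1)))).
  by rewrite ler_wpM2l// ltW// dQ.
by rewrite mulrA ltr_pdivrMr ?ltr_wpDl// mulrC ltr_pM2l//; lra.
Qed.

Lemma ulim_derive t (beta q : R) : 0 < t ->
  b nk.1 nk.2 @[nk --> grid t] --> beta -> is_derive t 1 Q q ->
  is_derive t 1 (ulim a) (beta * q).
Proof.
move=> t0 bbeta dQ; apply: is_derive_relative dQ => e e0.
have /cvgrPdistC_le/(_ _ e0) [d d0 bd] := bbeta.
have d'0 : 0 < Num.min (d / 2) t by rewrite lt_min t0 divr_gt0.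
have main u v : 0 <= u -> u <= v -> t - d / 2 < u -> v < t + d / 2 ->
    `|ulim a v - ulim a u - beta * (Q v - Q u)| <= e * `|Q v - Q u|.
  move=> u0 uv ud vd.
  rewrite (ger0_norm (x := Q v - _)); last by rewrite subr_ge0; exact: ndQ.
  have := @ulim_increment (beta - e) (beta + e) u v u0 uv.
  suff h : exists2 d, 0 < d & \forall n \near U, forall k,
     u - d < node n k <= v -> beta - e <= b n k <= beta + e.
    by move=> /(_ h); rewrite ler_norml; lra.
  exists (d / 2); first by rewrite divr_gt0.
  apply: filterS bd => n bd k /andP[uk kv].
  have /= : `|b n k - beta| <= e by apply: bd; rewrite ltr_norml; lra.
  by rewrite ler_norml; lra.
exists (Num.min (d / 2) t) => // s /=; rewrite lt_min => /andP[sd st].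
move: sd st; rewrite !ltr_norml => sd st.
case/orP: (le_total t s) => ts; first by apply: main; lra.
have -> : ulim a s - ulim a t - beta * (Q s - Q t) =
  - (ulim a t - ulim a s - beta * (Q t - Q s)) by ring.
by rewrite normrN (distrC (Q s)); apply: main; lra.
Qed.

End Scheme.
End UltraLimit.

(** * Shooting for a singular initial value problem *)

Section Shooting.
Context {R : realType}.
Implicit Types (t m : R) (x y z : R -> R).

(** The equation x'' = - w(t) phi(t, x) as a first order system.  The running
    integral z of x is a third unknown so that the boundary condition only
    evaluates the solution. *)
Definition ivp (w : R -> R) (phi : R -> R -> R) m x y z : Prop :=
  [/\ continuous x, continuous y, continuous z,
      [/\ x 0 = 0, y 0 = m & z 0 = 0] &
      forall t, 0 < t ->
        [/\ is_derive t 1 x (y t), is_derive t 1 y (- phi t (x t) * w t) &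
            is_derive t 1 z (x t)]].

Context (w P : R -> R) (phi : R -> R -> R) (F : R).
Hypothesis cphi : continuous (fun q : R * R => phi q.1 q.2).
Hypothesis phiF : forall t u, `|phi t u| <= F.
Hypotheses (cP : continuous P) (ndP : {homo P : s t / s <= t}).
Hypothesis dP : forall t, 0 < t -> is_derive t 1 P (w t).

(** The weight is integrated exactly over each step, by an increment of P, so that
    its singularity at 0 does no harm. *)
Fixpoint euler (n : nat) m (k : nat) : R * R * R :=
  if k is k'.+1 then
    let u := euler n m k' in
    let h := node n k - node n k' in
    (u.1.1 + h * u.1.2,
     u.1.2 + (P (node n k) - P (node n k')) * - phi (node n k') u.1.1,
     u.2 + h * u.1.1)
  else (0, m, 0).

Lemma phi_cvg (T : Type) (G : set_system T) (FG : Filter G) (f g : T -> R)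
    (a b : R) :
  f @ G --> a -> g @ G --> b -> phi (f u) (g u) @[u --> G] --> phi a b.
Proof. by move=> fa gb; apply: continuous2_cvg fa gb; exact: (@cphi (a, b)). Qed.

Lemma euler_continuous n k :
  [/\ continuous (fun m => (euler n m k).1.1),
      continuous (fun m => (euler n m k).1.2) &
      continuous (fun m => (euler n m k).2)].
Proof.
elim: k => [|k [cx cy cz]] /=.
  by split=> m; [exact: cvg_cst|exact: cvg_id|exact: cvg_cst].
split=> m.
- by apply: cvgD; [exact: cx|apply: cvgM; [exact: cvg_cst|exact: cy]].
- apply: cvgD; first exact: cy.
  apply: cvgM; first exact: cvg_cst.
  by apply: cvgN; apply: phi_cvg; [exact: cvg_cst|exact: cx].
- by apply: cvgD; [exact: cz|apply: cvgM; [exact: cvg_cst|exact: cx]].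
Qed.

Section Limit.
Context (U : set_system nat) {UU : UltraFilter U}.
Hypothesis hU : \oo `<=` U.

(** This compactness argument replaces continuous dependence on m, which may
    fail without a Lipschitz condition on phi; the slopes may vary with the mesh. *)
Lemma euler_limit (ms : nat -> R) M : (forall n, `|ms n| <= M) ->
  let a n k := (euler n (ms n) k).1.1 in
  let b n k := (euler n (ms n) k).1.2 in
  let c n k := (euler n (ms n) k).2 in
  [/\ ivp w phi (lim (ms @ U)) (ulim U a) (ulim U b) (ulim U c),
      forall t, a n (node_index n t) @[n --> U] --> ulim U a t &
      forall t, c n (node_index n t) @[n --> U] --> ulim U c t].
Proof.
move=> msM a b c.
have M0 : 0 <= M by apply: le_trans (msM 0%N).
have bS n k : b n k.+1 =
  b n k + (P (node n k.+1) - P (node n k)) * - phi (node n k) (a n k) by [].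
have aS n k : a n k.+1 = a n k + (node n k.+1 - node n k) * b n k by [].
have cS n k : c n k.+1 = c n k + (node n k.+1 - node n k) * a n k by [].
have a0 n : `|a n 0%N| <= 0 by rewrite normr0.
have c0 n : `|c n 0%N| <= 0 by rewrite normr0.
have b0 n : `|b n 0%N| <= M by exact: msM.
have phib : locally_bounded (fun n k => - phi (node n k) (a n k)).
  by move=> T; exists F => n k _; rewrite normrN.
have cid : continuous (@id R) by move=> t; exact: cvg_id.
have ndid : {homo @id R : s t / s <= t} by [].
have bb := scheme_bounded ndP b0 phib bS.
have ab := scheme_bounded ndid a0 bb aS.
have at0 (d : nat -> nat -> R) : ulim U d (0 : R) = lim (d n 0%N @[n --> U]).
  rewrite /ulim; suff -> : (fun n => d n (node_index n (0 : R))) = d^~ 0%N by [].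
  by apply/funext => n; rewrite node_index_le0.
have lim0 : lim ((fun=> 0 : R) @ U) = 0 by apply: cvg_lim => //; exact: cvg_cst.
split.
- split.
  + exact: (ulim_continuous hU cid ndid a0 bb aS).
  + exact: (ulim_continuous hU cP ndP b0 phib bS).
  + exact: (ulim_continuous hU cid ndid c0 ab cS).
  + by split; rewrite at0.
  + move=> t t0; split.
    * rewrite -[ulim U b t]mulr1.
      apply: (ulim_derive hU cid ndid a0 bb aS t0).
      exact: (scheme_grid hU cP ndP b0 phib bS (ltW t0)).
    * apply: (ulim_derive hU cP ndP b0 phib bS t0); last exact: dP.
      apply: cvgN; apply: phi_cvg; first exact: node_cvg.
      exact: (scheme_grid hU cid ndid a0 bb aS (ltW t0)).
    * rewrite -[ulim U a t]mulr1.
      apply: (ulim_derive hU cid ndid c0 ab cS t0).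
      exact: (scheme_grid hU cid ndid a0 bb aS (ltW t0)).
- exact: (scheme_cvg ndid a0 bb aS).
- exact: (scheme_cvg ndid c0 ab cS).
Qed.

End Limit.

(** The strict signs assumed for all solutions at the end slopes hold, up to
    equality, for almost all Euler schemes, whose boundary functional therefore
    vanishes at some slope in [m0, m1]; the limit of these schemes is the desired
    solution. *)
Theorem shooting (lambda eta m0 m1 : R) : m0 <= m1 ->
  (forall x y z, ivp w phi m0 x y z -> lambda * z eta < x 1) ->
  (forall x y z, ivp w phi m1 x y z -> x 1 < lambda * z eta) ->
  exists m x y z, [/\ m0 <= m <= m1, ivp w phi m x y z & x 1 = lambda * z eta].
Proof.
move=> m01 pos0 neg1.
have [U [UU hU]] := ultraFilterLemma (eventually_filter : ProperFilter \oo).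
pose B n m := (euler n m (node_index n (1 : R))).1.1
  - lambda * (euler n m (node_index n eta)).2.
have cB n : continuous (B n).
  have [cx _ _] := euler_continuous n (node_index n (1 : R)).
  have [_ _ cz] := euler_continuous n (node_index n eta).
  move=> m; apply: cvgB; first exact: cx.
  by apply: cvgM; [exact: cvg_cst|exact: cz].
(* Along U the boundary functional of Euler schemes converges to the one of
   their limit. *)
have Blim (ms : nat -> R) : (forall n, m0 <= ms n <= m1) ->
  exists x y z, ivp w phi (lim (ms @ U)) x y z /\
    B n (ms n) @[n --> U] --> x 1 - lambda * z eta.
  move=> ms01.
  have msM n : `|ms n| <= `|m0| + `|m1|.
    have := ms01 n; move: (ler_norm m1) (ler_norm (- m0)); rewrite normrN ler_norml.
    move: (normr_ge0 m0) (normr_ge0 m1); lra.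
  have [sol cx cz] := euler_limit hU msM.
  do 3 eexists; split; first exact: sol.
  by apply: cvgB; [exact: cx|apply: cvgM; [exact: cvg_cst|exact: cz]].
have limc (m : R) : lim ((fun=> m) @ U) = m by apply: cvg_lim => //; exact: cvg_cst.
have B0 : \forall n \near U, 0 <= B n m0.
  have [|x [y [z []]]] := Blim (fun=> m0); first by move=> _; rewrite lexx.
  rewrite limc => /pos0 xz cv; have {}xz : 0 < x 1 - lambda * z eta by rewrite subr_gt0.
  by apply: filterS (cvgr_gt _ cv _ xz) => n /ltW.
have B1 : \forall n \near U, B n m1 <= 0.
  have [|x [y [z []]]] := Blim (fun=> m1); first by move=> _; rewrite lexx m01.
  rewrite limc => /neg1 xz cv; have {}xz : x 1 - lambda * z eta < 0 by rewrite subr_lt0.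
  by apply: filterS (cvgr_lt _ cv _ xz) => n /ltW.
have root n : exists m, m0 <= m <= m1 /\ (0 <= B n m0 -> B n m1 <= 0 -> B n m = 0).
  have [[b0 b1]|nb] := pselect (0 <= B n m0 /\ B n m1 <= 0); last first.
    by exists m0; rewrite lexx; split=> // b0 b1; case: nb.
  have [||m] := @IVT R (B n) m0 m1 0 m01; first exact: continuous_subspaceT.
    by rewrite ge_min le_max b0 b1 orbT.
  by rewrite in_itv/= => m01' Bm; exists m.
have [ms msP] := choice root.
have [n|x [y [z [sol cv]]]] := Blim ms; first by have [] := msP n.
exists (lim (ms @ U)), x, y, z; split=> //.
  have msc : ms @ U --> lim (ms @ U).
    apply: (@ultra_cvg _ U _ ms (`|m0| + `|m1|)) => n; have [+ _] := msP n.
    move: (ler_norm m1) (ler_norm (- m0)); rewrite normrN ler_norml.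
    move: (normr_ge0 m0) (normr_ge0 m1); lra.
  apply/andP; split; [apply: (cvgr_to_ge msc)|apply: (cvgr_to_le msc)];
    by apply: filterE => n; have [/andP[]] := msP n.
apply/eqP; rewrite -subr_eq0; apply/eqP.
have <- : lim (B n (ms n) @[n --> U]) = x 1 - lambda * z eta by exact: cvg_lim.
apply: cvg_lim => //; apply: cvg_near_cst.
by apply: filterS2 B0 B1 => n b0 b1; have [_] := msP n; exact.
Qed.

End Shooting.

(** * Green functions and the sign of the boundary functional *)

Section Powers.
Context {R : realType}.

Lemma powR_continuous_gt0 (r t : R) : 0 < t -> {for t, continuous (@powR R ^~ r)}.
Proof.
by move=> t0; apply: is_derive_continuous; exact: is_derive1_powR.
Qed.

Lemma powR_max_continuous (theta r : R) : 0 < theta ->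
  continuous (fun s => Num.max s theta `^ r).
Proof.
move=> theta0 s; apply: (@continuous_comp _ _ _ (id \max cst theta) (@powR R ^~ r)).
  by apply: continuous_max; [exact: cvg_id|exact: cvg_cst].
by apply: powR_continuous_gt0; rewrite /= lt_max theta0 orbT.
Qed.

(** Negative reals have real powers equal to 1, hence the cut at 0. *)
Lemma powR_max0_continuous (r : R) : 0 < r ->
  continuous (fun s : R => Num.max s 0 `^ r).
Proof.
move=> r0 s; have [s0|s0] := ltP 0 s.
  apply: (@continuous_comp _ _ _ (id \max cst (0 : R)) (@powR R ^~ r)).
    by apply: continuous_max; [exact: cvg_id|exact: cvg_cst].
  by apply: powR_continuous_gt0; rewrite /= lt_max s0.
apply/cvgrPdist_lt => e e0; rewrite max_r// powR0 ?gt_eqF//.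
exists (e `^ r^-1) => /= [|u]; first exact: powR_gt0.
rewrite sub0r normrN ger0_norm ?powR_ge0// => us.
rewrite -[ltRHS](powRr1 (ltW e0)) -(mulVf (lt0r_neq0 r0)) powRrM.
apply: gt0_ltr_powR; rewrite // ?nnegrE ?powR_ge0 ?le_max ?lexx ?orbT//.
by rewrite gt_max powR_gt0// andbT; move: us; rewrite /ball_/= ltr_norml; lra.
Qed.

End Powers.

Section Green.
Context {R : realType} (alpha : R) (phi : R -> R -> R) (m : R) (x y z : R -> R).
Hypothesis phi0 : forall t u, 0 <= phi t u.
Hypothesis sol : ivp (fun t => t `^ (alpha - 2)) phi m x y z.
Implicit Types (s t eta lambda : R).

Let cx : continuous x. Proof. by case: sol. Qed.
Let cy : continuous y. Proof. by case: sol. Qed.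
Let cz : continuous z. Proof. by case: sol. Qed.
Let x0 : x 0 = 0. Proof. by case: sol => _ _ _ []. Qed.
Let y0 : y 0 = m. Proof. by case: sol => _ _ _ []. Qed.
Let z0 : z 0 = 0. Proof. by case: sol => _ _ _ []. Qed.
Let dx s : 0 < s -> is_derive s 1 x (y s).
Proof. by case: sol => _ _ _ _ /[apply] -[]. Qed.
Let dy s : 0 < s -> is_derive s 1 y (- phi s (x s) * s `^ (alpha - 2)).
Proof. by case: sol => _ _ _ _ /[apply] -[]. Qed.
Let dz s : 0 < s -> is_derive s 1 z (x s).
Proof. by case: sol => _ _ _ _ /[apply] -[]. Qed.

Lemma mulr_powRB2 s : 0 < s -> s * s `^ (alpha - 2) = s `^ (alpha - 1).
Proof.
move=> s0; rewrite -[X in X * _]powRr1 ?ltW// -powRD.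
  by congr (_ `^ _); ring.
by apply/implyP => _; rewrite gt_eqF.
Qed.

(** A primitive of calG t s * phi s (x s).  With x'' = - s^(alpha - 2) phi, the
    function x - s x' has derivative - s x'', and (1 - s) x' + x has derivative
    (1 - s) x''. *)
Definition greenG t : R -> R :=
  glue t (cst (1 - t) * (x - id * y)) (cst (- t) * ((cst 1 - id) * y + x)).

(** A primitive of calH eta s * phi s (x s).  On s < eta the kernel is
    q s * s^(alpha - 2) with q s = (2 eta - eta^2) s - s^2, and integrating - q x''
    by parts twice gives - q x' + q' x + 2 z because q'' = - 2. *)
Definition greenH eta : R -> R :=
  glue eta ((id ^+ 2 - cst (2 * eta - eta ^+ 2) * id) * y
            + (cst (2 * eta - eta ^+ 2) - cst 2 * id) * x + cst 2 * z)
           (cst (- eta ^+ 2) * ((cst 1 - id) * y + x)).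

Lemma greenG_continuous t : continuous (greenG t).
Proof.
apply: glue_continuous => s.
  apply: continuousM; first exact: cst_continuous.
  apply: continuousB; first exact: cx.
  by apply: continuousM; [exact: cvg_id|exact: cy].
apply: continuousM; first exact: cst_continuous.
apply: continuousD; last exact: cx.
apply: continuousM; last exact: cy.
by apply: continuousB; [exact: cst_continuous|exact: cvg_id].
Qed.

Lemma greenH_continuous eta : continuous (greenH eta).
Proof.
apply: glue_continuous => s.
  apply: continuousD; last by apply: continuousM; [exact: cst_continuous|exact: cz].
  apply: continuousD.
    apply: continuousM; last exact: cy.
    apply: continuousB; first by apply: continuousM; exact: cvg_id.
    by apply: continuousM; [exact: cst_continuous|exact: cvg_id].
  apply: continuousM; last exact: cx.
  apply: continuousB; first exact: cst_continuous.
  by apply: continuousM; [exact: cst_continuous|exact: cvg_id].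
apply: continuousM; first exact: cst_continuous.
apply: continuousD; last exact: cx.
apply: continuousM; last exact: cy.
by apply: continuousB; [exact: cst_continuous|exact: cvg_id].
Qed.

Lemma greenG_derive t s : 0 < s -> s != t ->
  is_derive s 1 (greenG t) (calG alpha t s * phi s (x s)).
Proof.
move=> s0 st; have dxs := dx s0; have dys := dy s0; rewrite /calG.
have dc (c : R) : is_derive s 1 (cst c) 0 by exact: is_derive_cst.
have did : is_derive s 1 (@id R) 1 by exact: is_derive_id.
have [ts|ts|] := ltgtP s t; last by move/eqP; rewrite (negPf st).
- have D := is_deriveM (dc (1 - t)) (is_deriveB dxs (is_deriveM did dys)).
  apply: (glue_derive_lt _ ts (is_derive_eq D _)).
  rewrite !fctE /GRing.scale/= -(mulr_powRB2 s0); ring.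
- have D := is_deriveM (dc (- t))
    (is_deriveD (is_deriveM (is_deriveB (dc 1) did) dys) dxs).
  apply: (glue_derive_gt _ ts (is_derive_eq D _)).
  rewrite !fctE /GRing.scale/=; ring.
Qed.

Lemma greenH_derive eta s : 0 < s -> s != eta ->
  is_derive s 1 (greenH eta) (calH alpha eta s * phi s (x s)).
Proof.
move=> s0 st; have dxs := dx s0; have dys := dy s0; have dzs := dz s0; rewrite /calH.
have dc (c : R) : is_derive s 1 (cst c) 0 by exact: is_derive_cst.
have did : is_derive s 1 (@id R) 1 by exact: is_derive_id.
have [ts|ts|] := ltgtP s eta; last by move/eqP; rewrite (negPf st).
- have dq := is_deriveB (is_deriveX 2 did) (is_deriveM (dc (2 * eta - eta ^+ 2)) did).
  have dq' := is_deriveB (dc (2 * eta - eta ^+ 2)) (is_deriveM (dc 2) did).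
  have D := is_deriveD (is_deriveD (is_deriveM dq dys) (is_deriveM dq' dxs))
    (is_deriveM (dc 2) dzs).
  apply: (glue_derive_lt _ ts (is_derive_eq D _)).
  rewrite !fctE /GRing.scale/= -(mulr_powRB2 s0); ring.
- have D := is_deriveM (dc (- eta ^+ 2))
    (is_deriveD (is_deriveM (is_deriveB (dc 1) did) dys) dxs).
  apply: (glue_derive_gt _ ts (is_derive_eq D _)).
  rewrite !fctE /GRing.scale/=; ring.
Qed.

(** The representation of x by the Green function of x'' with zero end values. *)
Lemma greenG_total t : 0 <= t <= 1 -> greenG t 1 - greenG t 0 = x t - t * x 1.
Proof.
move=> /andP[t0 t1]; rewrite /greenG /glue min_r// max_l// min_l// max_r//.
rewrite !fctE/= x0; ring.
Qed.

(** The kernel calH eta s is twice the integral of calG t s over t in [0, eta]. *)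
Lemma greenH_total eta : 0 <= eta <= 1 ->
  greenH eta 1 - greenH eta 0 = 2 * z eta - eta ^+ 2 * x 1.
Proof.
move=> /andP[t0 t1]; rewrite /greenH /glue min_r// max_l// min_l// max_r//.
rewrite !fctE/= x0 z0; ring.
Qed.

Lemma slope_nonincreasing s t : 0 <= s -> s <= t -> y t <= y s.
Proof.
move=> s0 st; rewrite -lerN2.
apply: (@nondecr_except _ [::] (- y) (fun u => phi u (x u) * u `^ (alpha - 2)))
  => [//|u _|u /andP[su _] _]; first by apply: continuousN; exact: cy.
split; last by rewrite mulr_ge0 ?powR_ge0.
by have := is_deriveN (dy (le_lt_trans s0 su)); rewrite mulNr opprK.
Qed.

Lemma secant_bounds s t : 0 <= s -> s <= t ->
  y t * (t - s) <= x t - x s <= y s * (t - s).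
Proof.
move=> s0 st.
have lin (c u : R) : is_derive u 1 (cst c * id : R -> R) c.
  apply: (is_derive_eq (is_deriveM (is_derive_cst c u 1) (is_derive_id u 1))).
  by rewrite /GRing.scale/=; ring.
have clin (c u : R) : {for u, continuous (cst c * id : R -> R)}.
  exact: is_derive_continuous (lin c u).
have linE (c : R) : c * (t - s) = (cst c * id : R -> R) t - (cst c * id : R -> R) s.
  by rewrite !fctE/= mulrBr.
rewrite (linE (y t)) (linE (y s)).
apply/andP; split.
  apply: (@le_increment _ [::] _ (fun=> y t) _ y) => [//|u _|u _|u /andP[su ut] _].
  - exact: clin.
  - exact: cx.
  - split; [exact: lin|apply: dx|apply: slope_nonincreasing]; lra.
apply: (@le_increment _ [::] _ y _ (fun=> y s)) => [//|u _|u _|u /andP[su ut] _].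
- exact: cx.
- exact: clin.
- split; [apply: dx|exact: lin|apply: slope_nonincreasing]; lra.
Qed.

(** The slope at s separates the secants of its two sides, as x' is
    nonincreasing. *)
Lemma concave_chord a s b : 0 <= a -> a <= s -> s <= b ->
  (b - s) * x a + (s - a) * x b <= (b - a) * x s.
Proof.
move=> a0 as_ sb.
have /andP[lo _] := secant_bounds a0 as_.
have /andP[_ hi] := secant_bounds (le_trans a0 as_) sb.
have sa0 : 0 <= s - a by rewrite subr_ge0.
have bs0 : 0 <= b - s by rewrite subr_ge0.
have := ler_wpM2l bs0 lo; have := ler_wpM2l sa0 hi; lra.
Qed.

Lemma calG_ge0 t s : 0 <= t <= 1 -> 0 <= s <= 1 -> 0 <= calG alpha t s.
Proof.
move=> t01 s01; rewrite /calG; case: ifP => _.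
  by rewrite mulr_ge0 ?powR_ge0//; lra.
by rewrite !mulr_ge0 ?powR_ge0//; lra.
Qed.

Lemma calH_ge0 eta s : 0 <= eta <= 1 -> 0 <= s <= 1 -> 0 <= calH alpha eta s.
Proof.
move=> eta01 s01; rewrite /calH; case: ifP => [se|_].
  have : 0 <= eta * (1 - eta) by rewrite mulr_ge0//; lra.
  by move=> ?; rewrite mulr_ge0 ?powR_ge0//; lra.
by rewrite !mulr_ge0 ?powR_ge0 ?sqr_ge0//; lra.
Qed.

Lemma calG_le_diag t s : 0 <= t <= 1 -> 0 < s <= 1 -> calG alpha t s <= calG alpha s s.
Proof.
move=> t01 /andP[s0 s1]; rewrite /calG lexx; case: ifPn => [st|].
  by rewrite ler_wpM2r ?powR_ge0//; lra.
rewrite -ltNge => ts; rewrite -(mulr_powRB2 s0) mulrA ler_wpM2r ?powR_ge0//.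
have : 0 <= (s - t) * (1 - s) by rewrite mulr_ge0//; lra.
lra.
Qed.

Lemma calH_le_diag eta s : 0 <= eta <= 1 -> 0 < s <= 1 ->
  calH alpha eta s <= calG alpha s s.
Proof.
move=> eta01 /andP[s0 s1]; rewrite /calG /calH lexx; case: ifPn => [st|].
  by rewrite ler_wpM2r ?powR_ge0//; have := sqr_ge0 (1 - eta); lra.
rewrite -ltNge => ts; rewrite -(mulr_powRB2 s0) mulrA ler_wpM2r ?powR_ge0//.
have e2 : 0 <= eta * (1 - eta) by rewrite mulr_ge0//; lra.
have : 0 <= (s - eta ^+ 2) * (1 - s) by rewrite mulr_ge0//; lra.
lra.
Qed.

Lemma calG_half_ge s : 0 < s <= 1 -> calG alpha s s / 2 <= calG alpha (1 / 2) s.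
Proof.
move=> /andP[s0 s1]; rewrite /calG lexx; case: ifPn => [st|].
  by rewrite mulrAC ler_wpM2r ?powR_ge0//; lra.
rewrite -ltNge => ts; rewrite -(mulr_powRB2 s0) mulrA mulrAC ler_wpM2r ?powR_ge0//.
have := sqr_ge0 (1 - s); lra.
Qed.

(** C is a primitive of the diagonal kernel calG s s, which dominates both Green
    kernels. *)
Section Upper.
Context (C : R -> R) (K : R).
Hypothesis dC : forall s, 0 <= s <= 1 ->
  is_derive s 1 C ((1 - s) * Num.max s 0 `^ (alpha - 1)).
Hypothesis gK : forall s, 0 < s < 1 -> phi s (x s) <= K.

Lemma kernel_upper (kernel Gam : R -> R) e : continuous Gam ->
  (forall s, 0 < s -> s != e -> is_derive s 1 Gam (kernel s * phi s (x s))) ->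
  (forall s, 0 < s < 1 -> 0 <= kernel s <= calG alpha s s) ->
  Gam 1 - Gam 0 <= K * (C 1 - C 0).
Proof.
move=> cG dG kG.
have -> : K * (C 1 - C 0) = (cst K * C) 1 - (cst K * C) 0 by rewrite !fctE; ring.
apply: (@le_increment _ [:: e] _ (fun s => kernel s * phi s (x s)) _
  (fun s => K * calG alpha s s)) => [//|s _|s s01|s s01].
- exact: cG.
- by apply: continuousM; [exact: cst_continuous|exact: is_derive_continuous (dC s01)].
- rewrite inE => se; have /andP[s0 s1] := s01; split; first exact: dG.
    have s01' : 0 <= s <= 1 by lra.
    apply: (is_derive_eq (is_deriveM (is_derive_cst K s 1) (dC s01'))).
    by rewrite /calG lexx (max_l (ltW s0)) /GRing.scale/=; ring.
  have /andP[k0 kd] := kG _ s01.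
  by rewrite mulrC; apply: ler_pM => //; exact: gK.
Qed.

Lemma green_upper t : 0 <= t <= 1 -> x t - t * x 1 <= K * (C 1 - C 0).
Proof.
move=> t01; rewrite -greenG_total//.
apply: (kernel_upper (kernel := calG alpha t) (e := t)).
- exact: greenG_continuous.
- by move=> s; exact: greenG_derive.
- by move=> s s01; rewrite calG_ge0 ?calG_le_diag//; lra.
Qed.

Lemma green_int_upper eta : 0 <= eta <= 1 ->
  2 * z eta - eta ^+ 2 * x 1 <= K * (C 1 - C 0).
Proof.
move=> eta01; rewrite -greenH_total//.
apply: (kernel_upper (kernel := calH alpha eta) (e := eta)).
- exact: greenH_continuous.
- by move=> s; exact: greenH_derive.
- by move=> s s01; rewrite calH_ge0 ?calH_le_diag//; lra.
Qed.

End Upper.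

Section Lower.
Context (theta eta c K : R) (E : R -> R).
Hypotheses (theta01 : 0 < theta < 1 / 2) (eta01 : 0 <= eta <= 1) (c0 : 0 <= c).
Hypothesis dE : forall s, theta <= s <= 1 - theta ->
  is_derive s 1 E (calG alpha s s + c * calH alpha eta s).
Hypothesis gK : forall s, theta <= s <= 1 - theta -> K <= phi s (x s).

(** The contribution of [0, theta] and [1 - theta, 1] is dropped: the primitives
    are nondecreasing.  At t = 1/2 the Green function is at least half of its
    diagonal. *)
Lemma green_lower : 0 <= K ->
  K / 2 * (E (1 - theta) - E theta) <=
  x (1 / 2) - x 1 / 2 + c / 2 * (2 * z eta - eta ^+ 2 * x 1).
Proof.
move=> K0; have half01 : 0 <= (1 / 2 : R) <= 1 by lra.
have /andP[theta0 theta1] := theta01.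
rewrite -(greenH_total eta01).
have -> : x (1 / 2) - x 1 / 2 = x (1 / 2) - 1 / 2 * x 1 by ring.
rewrite -(greenG_total half01).
pose Gam := greenG (1 / 2) + cst (c / 2) * greenH eta.
pose g s := calG alpha (1 / 2) s * phi s (x s)
            + c / 2 * (calH alpha eta s * phi s (x s)).
have cG : continuous Gam.
  move=> s; apply: continuousD; first exact: greenG_continuous.
  by apply: continuousM; [exact: cst_continuous|exact: greenH_continuous].
have dG s : 0 < s -> s \notin [:: 1 / 2; eta] -> is_derive s 1 Gam (g s).
  move=> s0; rewrite !inE negb_or => /andP[sh se].
  apply: (is_derive_eq (is_deriveD (greenG_derive s0 sh)
    (is_deriveM (is_derive_cst (c / 2) s 1) (greenH_derive s0 se)))).
  by rewrite /g /GRing.scale/=; ring.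
have g0 s : 0 < s < 1 -> 0 <= g s.
  move=> s01; have s01' : 0 <= s <= 1 by lra.
  by rewrite addr_ge0 ?mulr_ge0 ?calG_ge0 ?calH_ge0.
have incr a b : 0 <= a -> a <= b -> b <= 1 -> Gam a <= Gam b.
  move=> a0 ab b1; apply: (@nondecr_except _ [:: 1 / 2; eta] _ g) => [//|s _|s sab se].
    exact: cG.
  have s0 : 0 < s by lra.
  by split; [exact: (dG s s0 se)|apply: g0; lra].
apply: (@le_trans _ _ (Gam (1 - theta) - Gam theta)); last first.
  have : Gam 0 <= Gam theta by apply: incr; lra.
  have : Gam (1 - theta) <= Gam 1 by apply: incr; lra.
  by rewrite /Gam !fctE; lra.
have -> : K / 2 * (E (1 - theta) - E theta) =
  (cst (K / 2) * E) (1 - theta) - (cst (K / 2) * E) theta by rewrite !fctE; ring.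
apply: (@le_increment _ [:: 1 / 2; eta] _
  (fun s => K / 2 * (calG alpha s s + c * calH alpha eta s)) _ g) => [|s st|s _|s st se].
- lra.
- apply: continuousM; first exact: cst_continuous.
  exact: is_derive_continuous (dE st).
- exact: cG.
- have st' : theta <= s <= 1 - theta by lra.
  have s0 : 0 < s by lra.
  split; [|exact: (dG s s0 se)|].
    apply: (is_derive_eq (is_deriveM (is_derive_cst (K / 2) s 1) (dE st'))).
    by rewrite /GRing.scale/=; ring.
  have s01 : 0 < s <= 1 by lra.
  have s01' : 0 <= s <= 1 by lra.
  have G1 := calG_half_ge s01.
  have H0 := calH_ge0 eta01 s01'.
  have gK' := gK st'.
  have G0 := calG_ge0 s01' s01'.
  have -> : g s = (calG alpha (1 / 2) s + c / 2 * calH alpha eta s) * phi s (x s).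
    by rewrite /g; ring.
  have -> : K / 2 * (calG alpha s s + c * calH alpha eta s) =
    (calG alpha s s / 2 + c / 2 * calH alpha eta s) * K by ring.
  apply: ler_pM => //; last exact: lerD.
  by rewrite addr_ge0 ?mulr_ge0 ?divr_ge0.
Qed.

End Lower.

End Green.

Section Sign.
Context {R : realType} (alpha : R) (phi : R -> R -> R) (m : R) (x y z : R -> R).
Hypothesis phi0 : forall t u, 0 <= phi t u.
Hypothesis sol : ivp (fun t => t `^ (alpha - 2)) phi m x y z.
Context (eta lambda : R).
Implicit Types (s t u k : R).
Hypotheses (eta01 : 0 <= eta <= 1) (lambda0 : 0 <= lambda).
Hypothesis lambda_eta : lambda * eta ^+ 2 < 2.

Let lambda' := lambda / (2 - lambda * eta ^+ 2).

Let cx : continuous x. Proof. by case: sol. Qed.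
Let cy : continuous y. Proof. by case: sol. Qed.
Let cz : continuous z. Proof. by case: sol. Qed.
Let x0 : x 0 = 0. Proof. by case: sol => _ _ _ []. Qed.
Let y0 : y 0 = m. Proof. by case: sol => _ _ _ []. Qed.
Let z0 : z 0 = 0. Proof. by case: sol => _ _ _ []. Qed.
Let dz (s : R) : 0 < s -> is_derive s 1 z (x s).
Proof. by case: sol => _ _ _ _ /[apply] -[]. Qed.
Let dy (s : R) : 0 < s -> is_derive s 1 y (- phi s (x s) * s `^ (alpha - 2)).
Proof. by case: sol => _ _ _ _ /[apply] -[]. Qed.

Lemma lambda'_ge0 : 0 <= lambda'.
Proof. by rewrite divr_ge0// subr_ge0 ltW. Qed.

Lemma ivp_le_slope t : 0 <= t -> x t <= m * t.
Proof.
move=> t0; have /andP[_] := secant_bounds phi0 sol (lexx 0) t0.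
by rewrite x0 y0 !subr0.
Qed.

Lemma ivp_pos_near0 : 0 < m -> exists2 s, 0 < s <= 1 & 0 < x s.
Proof.
move=> m0; have y0' : 0 < y 0 by rewrite y0.
have [d /= d0 yd] := cvgr_gt _ (@cy 0) _ y0'.
pose s := Num.min (d / 2) 1.
have s0 : 0 < s by rewrite lt_min divr_gt0/=.
have sd : s < d by rewrite gt_min; apply/orP; left; lra.
exists s; first by rewrite s0 ge_min lexx orbT.
have /andP[+ _] := secant_bounds phi0 sol (lexx 0) (ltW s0).
rewrite x0 !subr0; apply: lt_le_trans; rewrite mulr_gt0//; apply: yd.
by rewrite /ball_/= sub0r normrN gtr0_norm.
Qed.

Lemma ivp_max :
  exists c, [/\ 0 <= c <= 1, 0 <= x c & forall t, 0 <= t <= 1 -> x t <= x c].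
Proof.
have [c] := @EVT_max R x 0 1 ler01 (continuous_subspaceT cx).
rewrite in_itv/= => c01 xc; exists c; split=> [//||t t01].
  by rewrite -[leLHS]x0; apply: xc; rewrite in_itv/= lexx ler01.
by apply: xc; rewrite in_itv.
Qed.

(** If x(1) <= lambda z(eta), the H-identity gives x(1) <= lambda' k (max x) I with
    I = C 1 - C 0, and the G-identity at a maximum of x then gives
    max x <= k (1 + lambda') I max x, which is absurd. *)
Lemma small_slope (C : R -> R) k : 0 < m -> 0 <= k ->
  (forall s, 0 <= s <= 1 ->
    is_derive s 1 C ((1 - s) * Num.max s 0 `^ (alpha - 1))) ->
  (forall s, 0 < s < 1 -> phi s (x s) <= k * Num.max (x s) 0) ->
  0 <= C 1 - C 0 ->
  k * ((1 + lambda') * (C 1 - C 0)) < 1 ->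
  lambda * z eta < x 1.
Proof.
move=> m0 k0 dC gk I0 kI; rewrite ltNge; apply/negP => bc.
have [c [c01 xc0 xc]] := ivp_max.
have xc_gt0 : 0 < x c.
  have [s s01 /lt_le_trans] := ivp_pos_near0 m0; apply; apply: xc; lra.
have gK s : 0 < s < 1 -> phi s (x s) <= k * x c.
  move=> s01; apply: (le_trans (gk _ s01)); rewrite ler_wpM2l// ge_max xc0 andbT.
  by apply: xc; lra.
have := green_upper phi0 sol dC gK c01.
have := green_int_upper phi0 sol dC gK eta01.
set I := C 1 - C 0 in I0 kI *; set A := k * x c * I => zA xA.
have A0 : 0 <= A by rewrite !mulr_ge0.
have den : 0 < 2 - lambda * eta ^+ 2 by rewrite subr_gt0.
have x1 : x 1 <= lambda' * A.
  rewrite /lambda' mulrAC ler_pdivlMr//.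
  have := ler_wpM2l lambda0 zA; lra.
have cx1 : c * x 1 <= lambda' * A.
  have lA := mulr_ge0 lambda'_ge0 A0.
  have [x10|x10] := leP (x 1) 0.
    by apply: le_trans lA; rewrite mulr_ge0_le0//; case/andP: c01.
  by apply: le_trans x1; rewrite ler_piMl//; [exact: ltW|case/andP: c01].
have : x c <= x c * (k * ((1 + lambda') * I)).
  by rewrite /A in cx1 xA *; lra.
by rewrite ler_pMr// leNgt kI.
Qed.

(** Concavity gives x t >= t x(1), so x(1) >= lambda z(eta) >= x(1) lambda eta^2 / 2,
    which excludes x(1) < 0. *)
Lemma bc_nonneg : lambda * z eta <= x 1 ->
  0 <= x 1 /\ forall t, 0 <= t <= 1 -> 0 <= x t.
Proof.
move=> bc; have /andP[e0 e1] := eta01.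
have chord t : 0 <= t <= 1 -> t * x 1 <= x t.
  move=> /andP[t0 t1]; have := concave_chord phi0 sol (lexx 0) t0 t1.
  by rewrite x0; lra.
have dq s : is_derive s 1 (cst (x 1 / 2) * id ^+ 2 : R -> R) (x 1 * s).
  apply: (is_derive_eq (is_deriveM (is_derive_cst (x 1 / 2) s 1)
    (is_deriveX 2 (is_derive_id s 1)))).
  by rewrite /GRing.scale/=; field.
have zx : x 1 * eta ^+ 2 / 2 <= z eta.
  have : (cst (x 1 / 2) * id ^+ 2 : R -> R) eta
    - (cst (x 1 / 2) * id ^+ 2 : R -> R) 0 <= z eta - z 0.
    apply: (@le_increment _ [::] _ (fun s => x 1 * s) _ x)
      => [//|s _|s _|s /andP[s0 s1] _].
    - exact: is_derive_continuous (dq s).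
    - exact: cz.
    - by split; [exact: dq|exact: dz|rewrite mulrC; apply: chord; lra].
  by rewrite z0 !fctE; lra.
have x10 : 0 <= x 1.
  have := ler_wpM2l lambda0 zx; rewrite -subr_ge0 => h.
  have : 0 <= x 1 * (2 - lambda * eta ^+ 2) by lra.
  by rewrite pmulr_lge0// subr_gt0.
split=> // t t01; apply: le_trans (chord _ t01).
by rewrite mulr_ge0//; case/andP: t01.
Qed.

(** If x(1) >= lambda z(eta), then x is nonnegative and concave, and the identities
    at 1/2 give x(1/2) >= (k theta / 2) (E (1 - theta) - E theta) max x > max x, since
    theta^4 <= theta / 2.  The lower bound phi >= k u applies because m is too large for
    max x < L, so that x >= theta L on [theta, 1 - theta]. *)
Lemma large_slope (theta k L B : R) (E P : R -> R) :
  0 < theta < 1 / 2 -> 0 < m -> 0 <= k -> 0 < L ->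
  (forall s, theta <= s <= 1 - theta ->
     is_derive s 1 E (calG alpha s s + lambda' * calH alpha eta s)) ->
  continuous P -> (forall s, 0 < s -> is_derive s 1 P (s `^ (alpha - 2))) ->
  (forall s u, 0 <= s <= 1 -> u <= m -> theta * L <= u -> k * u <= phi s u) ->
  (forall s u, 0 <= s <= 1 -> 0 <= u <= L -> phi s u <= B) ->
  1 < k * (theta ^+ 4 * (E (1 - theta) - E theta)) ->
  L + B * (P 1 - P 0) < m ->
  x 1 < lambda * z eta.
Proof.
move=> /andP[theta0 theta1] m0 k0 L0 dE cP dP gk gB kJ mL.
rewrite ltNge; apply/negP => bc.
have [x10 xpos] := bc_nonneg bc.
have [c [c01 xc0 xc]] := ivp_max.
have /andP[c0 c1] := c01.
have [xcL|xcL] := ltP (x c) L.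
  (* If x < L then phi <= B, so the slope stays above L and x(1) > L. *)
  have yL : - (B * (P 1 - P 0)) <= y 1 - y 0.
    have dBP s : 0 < s -> is_derive s 1 (cst (- B) * P) (- B * s `^ (alpha - 2)).
      move=> s0; apply: (is_derive_eq (is_deriveM (is_derive_cst (- B) s 1) (dP s s0))).
      by rewrite /GRing.scale/=; ring.
    have -> : - (B * (P 1 - P 0)) = (cst (- B) * P) 1 - (cst (- B) * P) 0.
      by rewrite !fctE; ring.
    apply: (@le_increment _ [::] _ (fun s => - B * s `^ (alpha - 2)) _
      (fun s => - phi s (x s) * s `^ (alpha - 2))) => [//|s _|s _|s /andP[s0 s1] _].
    - by apply: continuousM; [exact: cst_continuous|exact: cP].
    - exact: cy.
    - split; [exact: dBP|exact: dy|].
      rewrite ler_wpM2r ?powR_ge0// lerN2; apply: gB; first by lra.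
      rewrite xpos ?(le_trans (xc _ _) (ltW xcL))//; lra.
  have /andP[+ _] := secant_bounds phi0 sol (lexx 0) ler01.
  rewrite x0 !subr0 mulr1 => y1x1.
  have x1c : x 1 <= x c by apply: xc; rewrite ler01 lexx.
  by move: yL; rewrite y0; lra.
have xpos' : 0 < x c by exact: lt_le_trans xcL.
(* Chords from the maximum point c to the ends of [0, 1], where x >= 0. *)
have low s : theta <= s <= 1 - theta -> theta * x c <= x s.
  move=> /andP[s0 s1]; have s01 : 0 <= s <= 1 by lra.
  have xs := xpos _ s01.
  have [sc|cs] := leP s c.
    have s0' : 0 <= s by lra.
    have := concave_chord phi0 sol (lexx 0) s0' sc; rewrite x0 mulr0 add0r !subr0 => h.
    apply: (@le_trans _ _ (s * x c)); first by rewrite ler_wpM2r.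
    by apply: (le_trans h); rewrite ler_piMl.
  have s1' : s <= 1 by lra.
  have h := concave_chord phi0 sol c0 (ltW cs) s1'.
  apply: (@le_trans _ _ ((1 - s) * x c)); first by rewrite ler_wpM2r//; lra.
  apply: (@le_trans _ _ ((1 - c) * x s)); last by rewrite ler_piMl//; lra.
  apply: le_trans h; rewrite lerDl mulr_ge0//; lra.
pose K := k * (theta * x c).
have K0 : 0 <= K by rewrite !mulr_ge0// ltW.
have gK s : theta <= s <= 1 - theta -> K <= phi s (x s).
  move=> st; have s01 : 0 <= s <= 1 by lra.
  apply: le_trans (gk _ (x s) _ _ _) => //.
  - by rewrite ler_wpM2l// low.
  - apply: le_trans (ivp_le_slope _) _; first by lra.
    by rewrite ler_piMr ?ltW//; lra.
  - by apply: le_trans (low _ st); rewrite ler_pM2l.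
have theta01 : 0 < theta < 1 / 2 by rewrite theta0.
have := green_lower phi0 sol theta01 eta01 lambda'_ge0 dE gK K0.
have den : 0 < 2 - lambda * eta ^+ 2 by rewrite subr_gt0.
have x1 : lambda' * (2 * z eta - eta ^+ 2 * x 1) <= x 1.
  by rewrite /lambda' mulrAC ler_pdivrMr//; lra.
have xh : x (1 / 2) <= x c by apply: xc; lra.
set J := E (1 - theta) - E theta in kJ *; set H := 2 * z eta - _ in x1 *.
rewrite /K => lo.
have kJ0 : 0 < k * J.
  have : 0 < theta ^+ 4 * (k * J) by lra.
  by rewrite pmulr_rgt0// exprn_gt0.
have th4 : theta ^+ 4 <= theta / 2.
  have t2 : theta ^+ 2 <= 1 by rewrite exprn_ile1//; lra.
  have : theta ^+ 2 * theta <= 1 * (1 / 2).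
    by apply: ler_pM => //; [exact: sqr_ge0|lra|lra].
  by move=> /(ler_wpM2l (ltW theta0)); lra.
have : x c < x c * (theta / 2 * (k * J)).
  rewrite ltr_pMr//; apply: lt_le_trans (ler_wpM2r (ltW kJ0) th4); lra.
by lra.
Qed.

End Sign.

(** * Solutions of the initial value problem in the conformable calculus *)

Section Conformable.
Context {R : realType} (alpha : R) (phi : R -> R -> R) (m : R) (x y z : R -> R).
Hypothesis cphi : continuous (fun q : R * R => phi q.1 q.2).
Hypothesis sol : ivp (fun t => t `^ (alpha - 2)) phi m x y z.
Implicit Types (s t h e : R).

(** Properness makes limits along one-sided increments unique. *)
Lemma within_dnbhs_proper (D : set R) :
  (forall e, 0 < e -> exists2 h, 0 < `|h| < e & D h) ->
  ProperFilter (within D (nbhs 0^')).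
Proof.
move=> Dh; apply: Build_ProperFilter_ex => P /= [e /= e0 eP].
have [h /andP[h0 he] Dh'] := Dh _ e0.
exists h; apply: eP => //; first by rewrite /ball_/= sub0r normrN.
by rewrite -normr_gt0.
Qed.

Lemma incr01_proper t : 0 < t <= 1 -> ProperFilter (incr01 t).
Proof.
move=> /andP[t0 t1]; apply: within_dnbhs_proper => e e0.
have m0 : 0 < Num.min (e / 2) t by rewrite lt_min t0 divr_gt0.
exists (- Num.min (e / 2) t); rewrite ?normrN ?gtr0_norm ?m0//=.
  by rewrite gt_min; apply/orP; left; lra.
have : Num.min (e / 2) t <= t by rewrite ge_min lexx orbT.
by rewrite in_itv/=; lra.
Qed.

Lemma conf_incr_proper t : 0 < t <= 1 -> ProperFilter (conf_incr alpha t).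
Proof.
move=> /andP[t0 t1]; apply: within_dnbhs_proper => e e0.
have tau0 : 0 < t `^ (2 - alpha) by exact: powR_gt0.
set tau := t `^ _ in tau0 *.
have m0 : 0 < Num.min (e / 2) (t / tau / 2) by rewrite lt_min !divr_gt0.
exists (- Num.min (e / 2) (t / tau / 2)); rewrite ?normrN ?gtr0_norm ?m0//=.
  by rewrite gt_min; apply/orP; left; lra.
have : Num.min (e / 2) (t / tau / 2) * tau <= t / 2.
  rewrite -ler_pdivlMr// [leRHS]mulrAC ge_min lexx orbT//.
have := mulr_gt0 m0 tau0.
by rewrite in_itv/= -/tau mulNr; lra.
Qed.

Lemma ivp_quotient t : 0 < t -> (x (t + h) - x t) / h @[h --> incr01 t] --> y t.
Proof.
move=> t0; apply: cvg_within_filter; apply/is_derive_quotientP.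
by case: sol => _ _ _ _ /(_ _ t0) [].
Qed.

Lemma ivp_deriv01 t : 0 < t <= 1 -> derivable01 x t /\ deriv01 x t = y t.
Proof.
move=> t01; have /andP[t0 t1] := t01; have xt := ivp_quotient t0.
have PF := incr01_proper t01.
by split; [apply/cvg_ex; exists (y t)|exact: cvg_lim].
Qed.

(** The factor t^(2 - alpha) in the conformable increment cancels the singular
    weight t^(alpha - 2). *)
Lemma ivp_conf_quot t : 0 < t <= 1 ->
  conf_quot alpha x t e @[e --> conf_incr alpha t] --> - phi t (x t).
Proof.
move=> t01; have /andP[t0 t1] := t01.
pose tau := t `^ (2 - alpha).
pose F := y \o (cst t + cst tau * id : R -> R).
have dF : is_derive (0 : R) 1 F (- phi t (x t)).
  have dl : is_derive (0 : R) 1 (cst t + cst tau * id : R -> R) tau.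
    apply: (is_derive_eq (is_deriveD (is_derive_cst t (0 : R) 1)
      (is_deriveM (is_derive_cst tau (0 : R) 1) (is_derive_id (0 : R) 1)))).
    by rewrite /GRing.scale/=; ring.
  have dy : is_derive ((cst t + cst tau * id : R -> R) 0) 1 y
      (- phi t (x t) * t `^ (alpha - 2)).
    have -> : (cst t + cst tau * id : R -> R) 0 = t by rewrite !fctE/= mulr0 addr0.
    by case: sol => _ _ _ _ /(_ _ t0) [].
  apply: (is_derive_eq (is_derive1_comp dy dl)).
  rewrite -mulrA -powRD; last by apply/implyP => _; rewrite gt_eqF.
  have -> : alpha - 2 + (2 - alpha) = 0 by ring.
  by rewrite powRr0 mulr1.
have cF : (F (0 + e) - F 0) / e @[e --> conf_incr alpha t] --> - phi t (x t).
  by apply: cvg_within_filter; exact/is_derive_quotientP.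
have PF := conf_incr_proper t01.
apply: cvg_trans cF; apply: near_eq_cvg.
rewrite near_withinE; apply: nearW => e /= te.
rewrite /conf_quot (ivp_deriv01 t01).2 (ivp_deriv01 _).2; last by rewrite in_itv in te.
by rewrite /F !fctE/= mulr0 addr0 add0r (mulrC e).
Qed.

Lemma ivp_conf_derive_pos t : 0 < t <= 1 -> conf_derive_pos alpha x t = - phi t (x t).
Proof.
move=> t01; have PF := conf_incr_proper t01.
by apply: cvg_lim => //; exact: ivp_conf_quot.
Qed.

Lemma ivp_conf_derive0 : conf_derive_pos alpha x s @[s --> 0^'+] --> - phi 0 (x 0).
Proof.
have cx : continuous x by case: sol.
have cp : - phi s (x s) @[s --> 0^'+] --> - phi 0 (x 0).
  apply: cvg_at_right_filter; apply: cvgN; apply: phi_cvg.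
  - exact: cphi.
  - by [].
  - exact: cx.
apply: cvg_trans cp; apply: near_eq_cvg; near=> s.
by rewrite ivp_conf_derive_pos//; apply/andP; split; near: s;
  [exact: nbhs_right_gt|exact: nbhs_right_le].
Unshelve. all: by end_near. Qed.

Lemma ivp_conf_derivable : conf_derivable alpha x.
Proof.
split=> [t|]; last by apply/cvg_ex; eexists; exact: ivp_conf_derive0.
by rewrite in_itv/= => t01; apply/cvg_ex; eexists; exact: ivp_conf_quot.
Qed.

Lemma ivp_conf_derive t : 0 <= t <= 1 -> conf_derive alpha x t = - phi t (x t).
Proof.
move=> /andP[t0 t1]; rewrite /conf_derive; case: eqVneq => [->|tn0].
  by apply: cvg_lim => //; exact: ivp_conf_derive0.
by rewrite ivp_conf_derive_pos// t1 lt_neqAle eq_sym tn0 t0.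
Qed.

(** z and a primitive of x given by Lebesgue integration have the same derivative. *)
Lemma ivp_integral eta : 0 <= eta ->
  z eta = (\int[lebesgue_measure]_(t in `[0, eta]) x t)%R.
Proof.
move=> eta0; case: sol => cx _ cz [_ _ z0] dz.
have [C dC <-] := antiderivative cx eta0.
have zC (f g : R -> R) : (forall s, 0 <= s <= eta -> {for s, continuous f}) ->
    (forall s, 0 <= s <= eta -> {for s, continuous g}) ->
    (forall s, 0 < s < eta -> is_derive s 1 f (x s)) ->
    (forall s, 0 < s < eta -> is_derive s 1 g (x s)) ->
    f eta - f 0 <= g eta - g 0.
  move=> cf cg df dg.
  apply: (@le_increment _ [::] _ x _ x) => [//|//|//|s s0 _].
  by split; [exact: df|exact: dg|].
have dzx s : 0 < s < eta -> is_derive s 1 z (x s) by case/andP => /dz[].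
have dCx s : 0 < s < eta -> is_derive s 1 C (x s).
  by move=> /andP[s0 s1]; apply: dC; rewrite !ltW.
have czx s : 0 <= s <= eta -> {for s, continuous z} by move=> _; exact: cz.
have cCx s : 0 <= s <= eta -> {for s, continuous C}.
  by move=> /dC; exact: is_derive_continuous.
apply/eqP; rewrite -[z eta]subr0 -[in X in _ - X]z0 eq_le.
by apply/andP; split; apply: zC.
Qed.

End Conformable.

(** * Truncation of the nonlinearity *)

Section Nonlinearity.
Context {R : realType} (f : R -> R -> R).
Hypothesis cf : {within `[0, 1] `*` `[0, +oo[,
  continuous (fun p : R * R => f p.1 p.2)}.
Hypothesis f0 : forall t x : R, t \in `[0, 1] -> 0 <= x -> 0 <= f t x.
Implicit Types (t u M : R).

(** The truncated nonlinearity is bounded and defined for all real arguments.  A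
    solution whose slope at 0 lies in ]0, M] is at most M on [0, 1] by concavity, so
    it does not see the cut at M; the cut at 0 is harmless once x >= 0 is known. *)
Definition clamp M u : R := Num.min (Num.max u 0) M.

Definition truncation M t u : R := f (clamp 1 t) (clamp M u).

Lemma clamp_itv M u : 0 <= M -> 0 <= clamp M u <= M.
Proof.
by move=> M0; rewrite /clamp le_min M0 andbT le_max lexx orbT ge_min lexx orbT.
Qed.

Lemma clamp_id M u : 0 <= u <= M -> clamp M u = u.
Proof. by move=> /andP[u0 uM]; rewrite /clamp max_l// min_l. Qed.

Lemma clamp_continuous M : continuous (clamp M).
Proof.
move=> u; apply: (@continuous_min _ _ (id \max cst (0 : R)) (cst M)).
  by apply: continuous_max; [exact: cvg_id|exact: cvg_cst].
exact: cvg_cst.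
Qed.

Lemma truncation_continuous M : 0 <= M ->
  continuous (fun q : R * R => truncation M q.1 q.2).
Proof.
move=> M0 q; pose c (p : R * R) := (clamp 1 p.1, clamp M p.2).
have cA p : (`[0, 1] `*` `[0, +oo[)%classic (c p).
  have /andP[a0 a1] := clamp_itv p.1 (@ler01 R).
  have /andP[b0 _] := clamp_itv p.2 M0.
  by split; rewrite /= in_itv/= ?a0 ?a1 ?b0.
have cc : (clamp 1 p.1, clamp M p.2) @[p --> q] --> (clamp 1 q.1, clamp M q.2).
  apply: (@cvg_pair _ _ _ _ (nbhs (clamp 1 q.1)) (nbhs (clamp M q.2))).
    apply: (@cvg_comp _ _ _ fst (clamp 1) _ (nbhs q.1)); first exact: cvg_fst.
    exact: clamp_continuous.
  apply: (@cvg_comp _ _ _ snd (clamp M) _ (nbhs q.2)); first exact: cvg_snd.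
  exact: clamp_continuous.
move/subspace_continuousP: cf => /(_ _ (cA q)) cfq S /cfq /cc.
by apply: (@filterS _ (nbhs q)) => p; apply; exact: cA.
Qed.

Lemma truncation_ge0 M t u : 0 <= M -> 0 <= truncation M t u.
Proof.
move=> M0; apply: f0; first by rewrite in_itv/= clamp_itv.
by have /andP[] := clamp_itv u M0.
Qed.

Lemma truncationE M t u : 0 <= t <= 1 -> u <= M -> 0 <= M ->
  truncation M t u = f t (Num.max u 0).
Proof.
move=> t01 uM M0; rewrite /truncation clamp_id//.
by rewrite /clamp min_l// ge_max uM.
Qed.

Lemma nonlinearity_bounded M : 0 <= M ->
  exists2 B, 0 <= B & forall t u, 0 <= t <= 1 -> 0 <= u <= M -> f t u <= B.
Proof.
move=> M0; pose K : set (R * R) := `[0, 1] `*` `[0, M].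
have cK : compact K by apply: compact_setX; exact: segment_compact.
have K0 : K !=set0 by exists (0, 0); split; rewrite /= in_itv/= lexx ?ler01.
have [c cK' cmax] := compact_EVT_max K0 cK
  (continuous_subspaceT (truncation_continuous M0)).
exists (truncation M c.1 c.2); first exact: truncation_ge0.
move=> t u t01 u0M; have := cmax (t, u).
rewrite /= truncationE//; last by case/andP: u0M.
rewrite max_l; last by case/andP: u0M.
by apply; rewrite inE; split; rewrite /= in_itv.
Qed.

Lemma section_continuous u : 0 < u ->
  {within `[0, 1], continuous (fun t => f t u / u)}.
Proof.
move=> u0; apply: (@subspace_eq_continuous _ _ _ (fun t => truncation u t u / u)).
  move=> t; rewrite inE/= in_itv/= => t01.
  by rewrite truncationE ?max_l// ltW.
apply: continuous_subspaceT => t; apply: cvgM; last exact: cvg_cst.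
apply: (phi_cvg (truncation_continuous (ltW u0))).
- exact: cvg_id.
- exact: cvg_cst.
Qed.

Lemma sublinear_bound (l : \bar R) (b : R) :
  (max01 (fun t => f t x / x))%:E @[x --> 0^'+] --> l -> (l < b%:E)%E ->
  exists k d, [/\ 0 <= k, k < b, 0 < d &
    forall t u, 0 <= t <= 1 -> 0 <= u < d -> f t u <= k * u].
Proof.
move=> fl lb.
have [k lk kb] : exists2 k : R, (l < k%:E)%E & k < b.
  case: l lb {fl} => [r| |]//=; rewrite ?lte_fin => rb.
    by exists ((r + b) / 2); rewrite ?lte_fin; lra.
  by exists (b - 1); rewrite ?ltNyr//; lra.
have [d /= d0 dk] := fl _ (open_ereal_lt' lk).
have fk t u : 0 <= t <= 1 -> 0 < u < d -> f t u <= k * u.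
  move=> t01 /andP[u0 ud].
  have : (max01 (fun t => f t u / u) < k)%R.
    by rewrite -lte_fin; apply: dk => //=; rewrite sub0r normrN gtr0_norm.
  have [c c01 [-> cmax]] := max01_attained (section_continuous u0).
  have := cmax t; rewrite in_itv/= => /(_ t01) h1 /(le_lt_trans h1).
  by rewrite ltr_pdivrMr// => /ltW.
have k0 : 0 <= k.
  have : 0 <= k * (d / 2).
    apply: le_trans (fk 0 (d / 2) _ _); [|lra|lra].
    by apply: f0; rewrite ?in_itv/= ?lexx ?ler01//; lra.
  by rewrite pmulr_lge0// divr_gt0.
exists k, d; split=> // t u t01 /andP[].
rewrite le_eqVlt => /predU1P[<- _|u0 ud]; last first.
  by apply: fk => //; rewrite u0.
(* At u = 0 the bound is inherited from u > 0 by continuity. *)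
have c0 : truncation d t u @[u --> 0^'+] --> truncation d t 0.
  apply: cvg_at_right_filter; apply: (phi_cvg (truncation_continuous (ltW d0))).
  - exact: cvg_cst.
  - exact: cvg_id.
have ck : k * u @[u --> 0^'+] --> k * (0 : R).
  by apply: cvg_at_right_filter; apply: cvgM; [exact: cvg_cst|exact: cvg_id].
have -> : f t 0 = truncation d t 0 by rewrite truncationE ?maxxx// ltW.
apply: (ler_cvg_to c0 ck); near=> v.
have v0 : 0 < v by near: v; exact: nbhs_right_gt.
have vd : v < d by near: v; exact: nbhs_right_lt.
rewrite truncationE ?max_l ?(ltW v0) ?(ltW vd) ?(ltW d0)//.
by apply: fk => //; rewrite v0.
Unshelve. all: by end_near. Qed.

Lemma superlinear_bound (l : \bar R) (b : R) :
  (min01 (fun t => f t x / x))%:E @[x --> +oo] --> l -> (b%:E < l)%E ->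
  exists k M, [/\ b < k, 0 < M &
    forall t u, 0 <= t <= 1 -> M <= u -> k * u <= f t u].
Proof.
move=> fl lb.
have [k bk kl] : exists2 k : R, b < k & (k%:E < l)%E.
  case: l lb {fl} => [r| |]//=; rewrite ?lte_fin => rb.
    by exists ((r + b) / 2); rewrite ?lte_fin; lra.
  by exists (b + 1); rewrite ?ltry//; lra.
have [M [_ Mk]] := fl _ (open_ereal_gt' kl).
exists k, (Num.max M 0 + 1); split=> //.
  by rewrite ltr_wpDl// le_max lexx orbT.
move=> t u t01 Mu.
have [u0 uM] : 0 < u /\ M < u.
  have : M <= Num.max M 0 by rewrite le_max lexx.
  have : 0 <= Num.max M 0 by rewrite le_max lexx orbT.
  by split; lra.
have : (k < min01 (fun t => f t u / u))%R by rewrite -lte_fin; exact: Mk.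
have [c c01 [-> cmin]] := min01_attained (section_continuous u0).
have := cmin t; rewrite in_itv/= => /(_ t01) h1 /lt_le_trans /(_ h1).
by rewrite ltr_pdivlMr// => /ltW.
Qed.

End Nonlinearity.

(** * Primitives of the weight and of the kernels *)

Section Weight.
Context {R : realType} (alpha : R).
Hypothesis alpha1 : 1 < alpha.

Let a1 : 0 < alpha - 1. Proof. by rewrite subr_gt0. Qed.

Definition weight_primitive (s : R) : R := Num.max s 0 `^ (alpha - 1) / (alpha - 1).

Lemma weight_primitive_continuous : continuous weight_primitive.
Proof.
move=> s; apply: cvgM; last exact: cvg_cst.
exact: powR_max0_continuous.
Qed.

Lemma weight_primitive_homo : {homo weight_primitive : s t / s <= t}.
Proof.
move=> s t st; rewrite ler_wpM2r ?invr_ge0 ?(ltW a1)//.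
apply: ge0_ler_powR; rewrite ?(ltW a1) ?nnegrE//.
- by rewrite le_max lexx orbT.
- by rewrite le_max lexx orbT.
by rewrite ge_max !le_max st lexx orbT.
Qed.

Lemma weight_primitive_derive (s : R) : 0 < s ->
  is_derive s 1 weight_primitive (s `^ (alpha - 2)).
Proof.
move=> s0; pose g := @powR R ^~ (alpha - 1) * cst (alpha - 1)^-1.
apply: (@near_eq_is_derive _ _ _ g).
  near=> u; rewrite /g /weight_primitive !fctE max_l// ltW//.
  by near: u; exact: lt_nbhsr.
apply: (is_derive_eq (is_deriveM (is_derive1_powR (alpha - 1) s0)
  (is_derive_cst (alpha - 1)^-1 s 1))).
rewrite /GRing.scale/= mulr0 add0r mulrA mulVf ?gt_eqF// mul1r.
by congr (_ `^ _); ring.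
Unshelve. all: by end_near. Qed.

Lemma diag_green_primitive : exists2 C : R -> R,
  (forall s : R, 0 <= s <= 1 ->
    is_derive s 1 C ((1 - s) * Num.max s 0 `^ (alpha - 1))) &
  C 1 - C 0 = (\int[lebesgue_measure]_(s in `[0, 1]) calG alpha s s)%R.
Proof.
have cc : continuous (fun s : R => (1 - s) * Num.max s 0 `^ (alpha - 1)).
  move=> s; apply: cvgM; last exact: powR_max0_continuous.
  by apply: cvgB; [exact: cvg_cst|exact: cvg_id].
have [C dC CE] := antiderivative cc ler01; exists C => //; rewrite CE.
apply: eq_Rintegral => s; rewrite inE/= in_itv/= => /andP[s0 _].
by rewrite /calG lexx max_l.
Qed.

Lemma mixed_green_primitive (theta eta c : R) : 0 < theta < 1 / 2 ->
  exists2 E : R -> R,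
    (forall s : R, theta <= s <= 1 - theta ->
      is_derive s 1 E (calG alpha s s + c * calH alpha eta s)) &
    E (1 - theta) - E theta = (\int[lebesgue_measure]_(s in `[theta, (1 - theta)%R])
      (calG alpha s s + c * calH alpha eta s))%R.
Proof.
move=> /andP[theta0 theta1].
(* A continuous extension of the kernel: calH factors as
   s^(alpha - 2) (eta^2 (1 - s) - max(eta - s, 0)^2). *)
pose e s := (1 - s) * Num.max s theta `^ (alpha - 1)
  + c * ((eta ^+ 2 * (1 - s) - Num.max (eta - s) 0 ^+ 2)
         * Num.max s theta `^ (alpha - 2)).
have ce : continuous e.
  have c1 : continuous (fun s : R => 1 - s).
    by move=> s; apply: cvgB; [exact: cvg_cst|exact: cvg_id].
  move=> s; apply: cvgD; first by apply: cvgM; [exact: c1|exact: powR_max_continuous].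
  apply: cvgM; first exact: cvg_cst.
  apply: cvgM; last exact: powR_max_continuous.
  apply: cvgB; first by apply: cvgM; [exact: cvg_cst|exact: c1].
  have cm : {for s, continuous (fun s : R => Num.max (eta - s) 0)}.
    apply: (@continuous_max _ _ (fun s => eta - s) (cst (0 : R))); last exact: cvg_cst.
    by apply: cvgB; [exact: cvg_cst|exact: cvg_id].
  by apply: cvgM; exact: cm.
have eE s : theta <= s <= 1 - theta -> e s = calG alpha s s + c * calH alpha eta s.
  move=> /andP[ts st]; have s0 : 0 < s by lra.
  rewrite /e max_l// /calG lexx /calH; congr (_ + c * _).
  case: ifPn => [se|]; last rewrite -ltNge => es.
    by rewrite max_l ?subr_ge0// -(mulr_powRB2 alpha s0); ring.
  by rewrite max_r ?subr_le0 ?ltW//; ring.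
have le : theta <= 1 - theta by lra.
have [E dE EE] := antiderivative ce le; exists E.
  by move=> s st; rewrite -eE//; exact: dE.
rewrite EE; apply: eq_Rintegral => s; rewrite inE/= in_itv/= => st.
by rewrite eE.
Qed.

(** The kernel is at least theta^alpha on [theta, 1 - theta].  This keeps Lambda1
    from being the inverse of 0. *)
Lemma mixed_green_gt0 (theta eta c : R) (E : R -> R) : 0 < theta < 1 / 2 ->
  0 <= eta <= 1 -> 0 <= c ->
  (forall s : R, theta <= s <= 1 - theta ->
    is_derive s 1 E (calG alpha s s + c * calH alpha eta s)) ->
  0 < E (1 - theta) - E theta.
Proof.
move=> /andP[theta0 theta1] eta01 c0 dE.
pose b := theta * theta `^ (alpha - 1).
have b0 : 0 < b by rewrite mulr_gt0// powR_gt0.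
have db (s : R) : is_derive s 1 (cst b * id : R -> R) b.
  apply: (is_derive_eq (is_deriveM (is_derive_cst b s 1) (is_derive_id s 1))).
  by rewrite /GRing.scale/=; ring.
apply: (@lt_le_trans _ _
  ((cst b * id : R -> R) (1 - theta) - (cst b * id : R -> R) theta)).
  by rewrite !fctE/= -mulrBr mulr_gt0//; lra.
apply: (@le_increment _ [::] _ (fun=> b) _
  (fun s => calG alpha s s + c * calH alpha eta s)) => [|s _|s st|s st _].
- lra.
- exact: is_derive_continuous (db s).
- exact: is_derive_continuous (dE s st).
- have st' : theta <= s <= 1 - theta by lra.
  split; [exact: db|exact: dE|].
  have s01 : 0 <= s <= 1 by lra.
  rewrite -[b]addr0; apply: lerD; last by rewrite mulr_ge0// calH_ge0.
  have s0 : 0 <= s by lra.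
  rewrite /calG lexx; apply: ler_pM; rewrite ?powR_ge0 ?(ltW theta0)//; first by lra.
  by apply: ge0_ler_powR; rewrite ?nnegrE ?(ltW theta0) ?(ltW a1)//; lra.
Qed.

End Weight.

(** * Existence of a positive solution *)

Theorem theorem3p5 (R : realType) (alpha eta theta lambda : R)
    (f : R -> R -> R) (f0 finf : \bar R)
    (halpha : 1 < alpha <= 2)
    (heta : 0 < eta <= 1)
    (htheta : 0 < theta < 1 / 2)
    (hlambda : 0 <= lambda < 2 / eta ^+ 2)
    (hfcont : {within `[0, 1] `*` `[0, +oo[,
                 continuous (fun p : R * R => f p.1 p.2)})
    (hfpos : forall t x : R, t \in `[0, 1] -> 0 <= x -> 0 <= f t x)
    (hf0 : (max01 (fun t => f t x / x))%:E @[x --> 0^'+] --> f0)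
    (hfinf : (min01 (fun t => f t x / x))%:E @[x --> +oo] --> finf)
    (hsub : (f0 < (Lambda2 alpha eta lambda)%:E)%E)
    (hsup : ((Lambda1 alpha eta theta lambda)%:E < finf)%E) :
  exists x : R -> R, positive_solution alpha eta lambda f x.
Proof.
have /andP[alpha1 _] := halpha; have /andP[eta0 eta1] := heta.
have /andP[theta0 theta1] := htheta; have /andP[lambda0 lambda_lt] := hlambda.
have eta01 : 0 <= eta <= 1 by rewrite ltW.
have leta : lambda * eta ^+ 2 < 2 by rewrite -ltr_pdivlMr// exprn_gt0.
pose lambda' := lambda / (2 - lambda * eta ^+ 2).
have l'0 : 0 <= lambda' by exact: lambda'_ge0.
have [C dC CE] := diag_green_primitive alpha1.
have [E dE EE] := mixed_green_primitive alpha eta lambda' htheta.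
have I0 : 0 <= C 1 - C 0.
  rewrite CE; apply: Rintegral_ge0 => s /=; rewrite in_itv/= => s01.
  exact: calG_ge0.
have J0 := mixed_green_gt0 alpha1 htheta eta01 l'0 dE.
have [k0 [d [k00 k0L d0 fk0]]] := sublinear_bound hfcont hfpos hf0 hsub.
have [k [M [Lk M0 fk]]] := superlinear_bound hfcont hfinf hsup.
have thJ : 0 < theta ^+ 4 * (E (1 - theta) - E theta) by rewrite mulr_gt0// exprn_gt0.
have kJ : 1 < k * (theta ^+ 4 * (E (1 - theta) - E theta)).
  by rewrite -ltr_pdivrMr// div1r EE.
have k_ge0 : 0 <= k.
  by apply: ltW; rewrite -(pmulr_lgt0 _ thJ); apply: lt_trans kJ.
have kI : k0 * ((1 + lambda') * (C 1 - C 0)) < 1.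
  have : 0 <= (1 + lambda') * (C 1 - C 0) by rewrite mulr_ge0// addr_ge0.
  rewrite le_eqVlt => /predU1P[<-|I1]; first by rewrite mulr0.
  by rewrite -ltr_pdivlMr// div1r CE.
pose L := M / theta.
have L0 : 0 < L by rewrite divr_gt0.
have [B B0 fB] := nonlinearity_bounded hfcont hfpos (ltW L0).
pose P := weight_primitive alpha.
have cP : continuous P by exact: weight_primitive_continuous.
have ndP : {homo P : s t / s <= t} by exact: weight_primitive_homo.
have dP (s : R) : 0 < s -> is_derive s 1 P (s `^ (alpha - 2)).
  exact: weight_primitive_derive.
(* The slopes: m0 keeps x below d, where f is sublinear; m1 is too
   large for a nonnegative solution to stay below L. *)
pose m0 := Num.min (d / 2) L.
pose m1 := L + B * (P 1 - P 0) + 1.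
have m00 : 0 < m0 by rewrite lt_min L0 divr_gt0.
have BP0 : 0 <= B * (P 1 - P 0) by rewrite mulr_ge0// subr_ge0 ndP.
have m01 : m0 <= m1.
  have : m0 <= L by rewrite ge_min lexx orbT.
  by rewrite /m1; lra.
have m10 : 0 < m1 by exact: lt_le_trans m01.
pose phi := truncation f m1.
have cphi : continuous (fun q : R * R => phi q.1 q.2).
  exact: (truncation_continuous hfcont (ltW m10)).
have phi0 t u : 0 <= phi t u by apply: truncation_ge0 => //; exact: ltW.
have [F F0 fF] := nonlinearity_bounded hfcont hfpos (ltW m10).
have phiF t u : `|phi t u| <= F.
  rewrite ger0_norm//; apply: fF; first exact: clamp_itv.
  by apply: clamp_itv; exact: ltW.
have phiE m x y z t : ivp (fun t => t `^ (alpha - 2)) phi m x y z -> 0 < m <= m1 ->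
    0 <= t <= 1 -> phi t (x t) = f t (Num.max (x t) 0).
  move=> sol /andP[mgt0 mm1] t01; apply: truncationE => //; last exact: ltW.
  have /andP[t0 t1] := t01.
  apply: le_trans (ivp_le_slope phi0 sol t0) _.
  by apply: le_trans mm1; rewrite ler_piMr// ltW.
have [||m [x [y [z [mm sol bc]]]]] := @shooting _ _ P phi F cphi phiF cP ndP dP
    lambda eta m0 m1 m01.
- move=> x y z sol.
  apply: (small_slope phi0 sol eta01 lambda0 leta m00 k00 dC _ I0 kI) => s s01.
  have s01' : 0 <= s <= 1 by lra.
  have s0 : 0 <= s by lra.
  rewrite (phiE _ _ _ _ _ sol)//; last by rewrite m00 m01.
  apply: fk0 => //; rewrite le_max lexx orbT/= gt_max d0 andbT.
  apply: le_lt_trans (ivp_le_slope phi0 sol s0) _.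
  apply: (@le_lt_trans _ _ m0); first by rewrite ler_piMr ?(ltW m00)//; lra.
  by rewrite gt_min; apply/orP; left; lra.
- move=> x y z sol.
  apply: (@large_slope _ _ _ _ _ _ _ phi0 sol _ _ eta01 lambda0 leta theta k L B E P
    htheta m10 k_ge0 L0 dE cP dP _ _ kJ _) => [s u s01 um1|s u s01 /andP[u0 uL]|].
  + rewrite /L mulrCA divff ?gt_eqF// mulr1 => Mu.
    have u0 : 0 <= u by apply: le_trans Mu; exact: ltW.
    by rewrite /phi truncationE ?max_l// ?(ltW m10)//; exact: fk.
  + rewrite /phi /truncation (clamp_id s01); apply: fB => //.
    have /andP[-> _] := clamp_itv u (ltW m10).
    by rewrite /clamp max_l// ge_min uL.
  + by rewrite /m1; lra.
have /andP[mm0 mm1] := mm.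
have mgt0 : 0 < m by exact: lt_le_trans mm0.
have bc' : lambda * z eta <= x 1 by rewrite bc.
have [x10 xpos] := bc_nonneg phi0 sol eta01 lambda0 leta bc'.
exists x; split; last first.
- have [s /andP[s0 s1] xs] := ivp_pos_near0 phi0 sol mgt0.
  by exists s; rewrite ?in_itv/= ?s1 ?ltW// gt_eqF.
- by move=> t; rewrite in_itv/=; exact: xpos.
split.
- by apply: continuous_subspaceT; case: sol.
- by move=> t; rewrite in_itv/= => t01; have [] := ivp_deriv01 sol t01.
- exact: ivp_conf_derivable cphi sol.
- move=> t; rewrite in_itv/= => t01.
  rewrite (ivp_conf_derive cphi sol t01) (phiE _ _ _ _ _ sol)//; last by rewrite mgt0.
  by rewrite max_l ?xpos// addNr.
- split; first by case: sol => _ _ _ [].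
  by rewrite bc (ivp_integral sol)// ltW.
Qed.
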